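(* There is a deterministic algorithm which, given a field $\mathbb{F}$, a nonconstant polynomial $f\in\mathbb{F}[x_1,\ldots,x_n]$ in sparse representation and an integer $e\ge 2$, computes a polynomial $g\in\mathbb{F}[x_1,\ldots,x_n]$ such that $g^e=f$, or determines that no such $g$ exists. Writing $s=\|f\|_0$, $d=\operatorname{indeg}(f)$ and $D=\operatorname{tdeg}(f)$, its running time is \[ \operatorname{poly}\bigl(s^{O(Dd)},n,d,D\bigr)+s\cdot R(e), \] where $R(e)$ denotes the cost of constructing a single $e$-th root of a scalar in the base field $\mathbb{F}$ and, when $\operatorname{char}(\mathbb{F})\mid e$, the cost of computing a single Frobenius root of a scalar (including both existence testing and construction).
   Context: For a polynomial $P$, $\|P\|_0$ is the number of monomials occurring in $P$ with nonzero coefficient. For nonzero $P$, $\operatorname{tdeg}(P)$ is its total degree, and $\operatorname{indeg}(P)$ is its individual degree (the maximum exponent of any single variable in any monomial of $P$). The sparse representation of $P$ is the list of its nonzero terms (coefficient, exponent vector). The implied constants and the polynomial are absolute. Running time is counted in operations on sparse polynomials: arithmetic operations in $\mathbb{F}$ and operations on exponent vectors have unit cost, while testing for existence of and constructing roots of scalars is charged separately through $R(e)$. If $p=\operatorname{char}(\mathbb{F})>0$ divides $e$ and $e=p^rq$ with $p\nmid q$, a Frobenius root of a scalar $A\in\mathbb{F}$ is the (unique, if it exists) element $B\in\mathbb{F}$ with $B^{p^r}=A$. *)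

(* Defs.v *)
From HB Require Import structures.
From mathcomp Require Import all_boot all_order all_algebra.
From mathcomp Require Export mpoly.

Set Implicit Arguments.
Unset Strict Implicit.
Unset Printing Implicit Defensive.

Import Order.TTheory GRing.Theory Num.Theory.

Local Open Scope ring_scope.

Section Degrees.
Variables (n : nat) (F : fieldType).
Implicit Type f : {mpoly F[n]}.

Definition sparsity f : nat := size (msupp f).

(* [msize f] is one more than the total degree of a nonzero [f]. *)
Definition tdeg f : nat := (msize f).-1.

Definition indeg f : nat := (\max_(m <- msupp f) \max_(i < n) m i)%N.

Definition nonconstant f : Prop := forall c : F, f <> c%:MP.

End Degrees.

(* The model of computation is a WHILE language over LISP-like data, whose
   atoms are natural numbers, scalars and exponent vectors.  A program is a
   finite object that depends neither on the field nor on the number of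
   variables: the only scalar constants it can mention are 0 and 1.  Every
   operation has unit cost, except the extraction of roots of scalars.
   Naturals can be added, subtracted and compared, but not multiplied, so that
   the unit cost does not hide any work on huge integers. *)

Inductive op1 :=
  | Hd | Tl
  | IsNat | IsScalar | IsMonom | IsCons
  | MUnit.           (* i |-> exponent vector of the variable of index i *)

Inductive op2 :=
  | Cons
  | Eq               (* on atoms only *)
  | Le               (* on naturals; monomial order on exponent vectors *)
  | Add
  | Sub              (* truncated on naturals and on exponent vectors *)
  | Mul              (* on scalars only *)
  | Div              (* on scalars; exponent vector by natural, rounded down *)
  | MLe              (* divisibility of monomials *)
  | MDvd             (* does a natural divide every exponent? *)
  | MGet.            (* exponent of the variable of given index *)

Inductive expr :=
  | Var of nat
  | ENil
  | ENat of nat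
  | EZero
  | EOne
  | EMon0
  | EOp1 of op1 & expr
  | EOp2 of op2 & expr & expr.

Inductive cmd :=
  | Assign of nat & expr
  | Seq of cmd & cmd
  | If of expr & cmd & cmd
  | While of expr & cmd
  | Root of nat & expr & expr   (* x := k-th root of a *)
  | Frob of nat & expr & expr.  (* x := Frobenius root of a, relative to k *)

Fixpoint expr_cost (E : expr) : nat :=
  match E with
  | EOp1 _ E1 => (expr_cost E1).+1
  | EOp2 _ E1 E2 => (expr_cost E1 + expr_cost E2).+1
  | _ => 1
  end.

Inductive value (F : fieldType) (n : nat) :=
  | VNil
  | VNat of nat
  | VScalar of F
  | VMonom of 'X_{1..n}
  | VCons of value F n & value F n.

Arguments VNil {F n}.
Arguments VNat {F n} _.
Arguments VScalar {F n} _.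
Arguments VMonom {F n} _.
Arguments VCons {F n} _ _.

(* An extraction of the root of order [k] of a scalar that tests existence. *)
Definition root_spec (F : fieldType) (k : nat) (a : F) (r : option F) : Prop :=
  match r with
  | Some b => b ^+ k = a
  | None => forall b : F, b ^+ k <> a
  end.

(* If the characteristic p of the field divides k, the Frobenius root relative
   to k is the root of order p ^ logn p k, i.e., p^r where k = p^r q and p does
   not divide q; otherwise nothing is known about [scalar_frob k]. *)
Record scalar_roots (F : fieldType) := ScalarRoots {
  scalar_root : nat -> F -> option F;
  scalar_frob : nat -> F -> option F;
  scalar_rootP : forall (k : nat) (a : F), (0 < k)%N ->
    root_spec k a (scalar_root k a);
  scalar_frobP : forall (p k : nat) (a : F),
    p \in [pchar F] -> (0 < k)%N -> (p %| k)%N ->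
    root_spec (p ^ logn p k)%N a (scalar_frob k a)
}.

Section Semantics.
Variables (F : fieldType) (n : nat).
Local Notation value := (value F n).
Implicit Types (u v : value) (b : bool).

Definition vbool b : value := VNat b.

(* [VNil] and [VNat 0] are the only values that count as false. *)
Definition truth v : bool :=
  match v with VNil | VNat 0 => false | _ => true end.

Definition mnm_div (m : 'X_{1..n}) (k : nat) : 'X_{1..n} :=
  [multinom (m i %/ k)%N | i < n].

(* Ill-typed and out-of-range operations return [VNil]. *)
Definition eval1 (o : op1) v : value :=
  match o, v with
  | Hd, VCons v1 _ => v1
  | Tl, VCons _ v2 => v2
  | IsNat, _ => vbool (if v is VNat _ then true else false)
  | IsScalar, _ => vbool (if v is VScalar _ then true else false)
  | IsMonom, _ => vbool (if v is VMonom _ then true else false)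
  | IsCons, _ => vbool (if v is VCons _ _ then true else false)
  | MUnit, VNat i => if insub i is Some j then VMonom U_(j)%MM else VNil
  | _, _ => VNil
  end.

Definition eval2 (o : op2) u v : value :=
  match o, u, v with
  | Cons, _, _ => VCons u v
  | Eq, VNil, VNil => vbool true
  | Eq, VNat i, VNat j => vbool (i == j)
  | Eq, VScalar a, VScalar b => vbool (a == b)
  | Eq, VMonom m, VMonom m' => vbool (m == m')
  | Le, VNat i, VNat j => vbool (i <= j)%N
  | Le, VMonom m, VMonom m' => vbool (m <= m')%O
  | Add, VNat i, VNat j => VNat (i + j)
  | Add, VScalar a, VScalar b => VScalar (a + b)
  | Add, VMonom m, VMonom m' => VMonom (m + m')%MM
  | Sub, VNat i, VNat j => VNat (i - j)
  | Sub, VScalar a, VScalar b => VScalar (a - b)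
  | Sub, VMonom m, VMonom m' => VMonom (m - m')%MM
  | Mul, VScalar a, VScalar b => VScalar (a * b)
  | Div, VScalar a, VScalar b => VScalar (a / b)
  | Div, VMonom m, VNat k => VMonom (mnm_div m k)
  | MLe, VMonom m, VMonom m' => vbool (m <= m')%MM
  | MDvd, VNat k, VMonom m => vbool [forall i : 'I_n, (k %| m i)%N]
  | MGet, VMonom m, VNat i => if insub i is Some j then VNat (m j) else VNil
  | _, _, _ => VNil
  end.

Definition store := nat -> value.

Definition upd (st : store) (x : nat) v : store :=
  fun y => if y == x then v else st y.

Fixpoint eval (st : store) (E : expr) : value :=
  match E with
  | Var x => st x
  | ENil => VNil
  | ENat k => VNat k
  | EZero => VScalar 0
  | EOne => VScalar 1
  | EMon0 => VMonom 0%MM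
  | EOp1 o E1 => eval1 o (eval st E1)
  | EOp2 o E1 E2 => eval2 o (eval st E1) (eval st E2)
  end.

Definition voption (r : option F) : value :=
  if r is Some b then VScalar b else VNil.

Variables (O : scalar_roots F) (R : nat -> nat).

Inductive exec : cmd -> store -> store -> nat -> Prop :=
  | ExecAssign st x E :
      exec (Assign x E) st (upd st x (eval st E)) (expr_cost E).+1
  | ExecSeq c1 c2 st0 st1 st2 t1 t2 :
      exec c1 st0 st1 t1 -> exec c2 st1 st2 t2 ->
      exec (Seq c1 c2) st0 st2 (t1 + t2)
  | ExecIfTrue E c1 c2 st st' t :
      truth (eval st E) -> exec c1 st st' t ->
      exec (If E c1 c2) st st' (expr_cost E + t).+1
  | ExecIfFalse E c1 c2 st st' t :
      ~~ truth (eval st E) -> exec c2 st st' t ->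
      exec (If E c1 c2) st st' (expr_cost E + t).+1
  | ExecWhileFalse E c st :
      ~~ truth (eval st E) ->
      exec (While E c) st st (expr_cost E).+1
  | ExecWhileTrue E c st0 st1 st2 t1 t2 :
      truth (eval st0 E) -> exec c st0 st1 t1 -> exec (While E c) st1 st2 t2 ->
      exec (While E c) st0 st2 (expr_cost E + t1 + t2).+1
  | ExecRoot x E1 E2 st k a :
      eval st E1 = VNat k -> eval st E2 = VScalar a ->
      exec (Root x E1 E2) st (upd st x (voption (scalar_root O k a)))
           (expr_cost E1 + expr_cost E2 + R k).+1
  | ExecFrob x E1 E2 st k a :
      eval st E1 = VNat k -> eval st E2 = VScalar a ->
      exec (Frob x E1 E2) st (upd st x (voption (scalar_frob O k a)))
           (expr_cost E1 + expr_cost E2 + R k).+1.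

Lemma exec_deterministic c st st1 st2 t1 t2 :
  exec c st st1 t1 -> exec c st st2 t2 -> st1 = st2 /\ t1 = t2.
Proof.
move=> H; elim: H st2 t2 => {c st st1 t1}.
- by move=> st x E st2 t2 H; inversion H.
- move=> c1 c2 st0 st1 st2 t1 t2 _ IH1 _ IH2 st3 t3 H.
  inversion H as [|? ? ? st1' ? ? ? H1 H2| | | | | |]; subst.
  by case: (IH1 _ _ H1) => ? ?; subst; case: (IH2 _ _ H2) => -> ->.
- move=> E c1 c2 st st' t HE _ IH st2 t2 H.
  inversion H as [| |? ? ? ? ? ? HE' H1|? ? ? ? ? ? HE' H1| | | |]; subst.
    by case: (IH _ _ H1) => -> ->.
  by rewrite HE in HE'.
- move=> E c1 c2 st st' t HE _ IH st2 t2 H.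
  inversion H as [| |? ? ? ? ? ? HE' H1|? ? ? ? ? ? HE' H1| | | |]; subst.
    by rewrite HE' in HE.
  by case: (IH _ _ H1) => -> ->.
- move=> E c st HE st2 t2 H.
  inversion H as [| | | | |? ? ? ? ? ? ? HE' H1 H2| |]; subst=> //.
  by rewrite HE' in HE.
- move=> E c st0 st1 st2 t1 t2 HE _ IH1 _ IH2 st3 t3 H.
  inversion H as [| | | |? ? ? HE'|? ? ? ? ? ? ? HE' H1 H2| |]; subst.
    by rewrite HE in HE'.
  by case: (IH1 _ _ H1) => ? ?; subst; case: (IH2 _ _ H2) => -> ->.
- move=> x E1 E2 st k a e1 e2 st2 t2 H.
  inversion H as [| | | | | |? ? ? ? ? ? e1' e2'|]; subst.
  by move: e1' e2'; rewrite e1 e2 => -[->] [->].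
- move=> x E1 E2 st k a e1 e2 st2 t2 H.
  inversion H as [| | | | | | |? ? ? ? ? ? e1' e2']; subst.
  by move: e1' e2'; rewrite e1 e2 => -[->] [->].
Qed.

(* The terms (coefficient, exponent vector) may be listed in any order. *)
Definition encode_terms (ts : seq (F * 'X_{1..n})) : value :=
  foldr (fun t v => VCons (VCons (VScalar t.1) (VMonom t.2)) v) VNil ts.

Definition sparse_repr (f : {mpoly F[n]}) v : Prop :=
  exists2 ts : seq (F * 'X_{1..n}),
    perm_eq ts [seq (f@_m, m) | m <- msupp f] & v = encode_terms ts.

(* Programs read their input in the variable 0 and leave their output there. *)
Definition init_store v : store := upd (fun=> VNil) 0 v.

Definition root_input (e : nat) v : value := VCons (VNat n) (VCons (VNat e) v).

(* The output [VNat 0], which represents no polynomial, means "no root". *)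
Definition root_output (f : {mpoly F[n]}) (e : nat) v : Prop :=
  (exists2 g : {mpoly F[n]}, sparse_repr g v & g ^+ e = f) \/
  (v = VNat 0 /\ forall g : {mpoly F[n]}, g ^+ e <> f).

End Semantics.

Definition poly4 (Q : {mpoly int[4]}) (a b c d : nat) : int :=
  Q.@[fun i : 'I_4 => (nth 0%N [:: a; b; c; d] i)%:Z].

(* Main.v *)
Require Import Defs.
From mathcomp Require Import all_boot all_order all_algebra.
From mathcomp Require Import zify ring.

(* If [g ^+ e = f] then, for every linear functional, the minimum over the support
   of [f] is [e] times the minimum over the support of [g]; hence [e] times every
   exponent vector of [g] lies in the convex hull of the support of [f].  A point of
   this hull is within distance 1/2 (after rescaling) of the average of [O(D * d)]
   vertices, because the vertices have squared Euclidean norm at most [D * d], so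
   [g], and likewise every power of a part of [g], has at most [s ^ (9 * (D * d))]
   terms.

   Write [e = P * q] where [P] is the part of [e] made of the characteristic.  After
   division by the leading coefficient [c], the [P]-th root of [f / c] is obtained
   term by term; its leading coefficient is 1, so that this takes [s - 1] Frobenius
   roots, and one [e]-th root of [c] is needed besides.  The monic [q]-th root of the
   result is found one term at a time, from the largest: if [g = h + r] with all the
   terms of [r] below those of [h], the leading term of [g ^+ q - h ^+ q] is
   [q * lt(h) ^+ (q - 1) * lt(r)], where [q] is invertible.  The sparsity bound limits
   both the number of steps and the size of the powers of [h]. *)

Set Implicit Arguments.
Unset Strict Implicit.
Unset Printing Implicit Defensive.

Import Order.TTheory GRing.Theory Num.Theory.

Local Open Scope ring_scope.

(** * Lattice points of a dilated polytope *)

Section InnerProduct.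
Variable n : nat.
Implicit Types (x y w : 'I_n -> int) (m : 'X_{1..n}).

Definition ip x y : int := \sum_i x i * y i.

Definition vec m : 'I_n -> int := fun i => (m i)%:Z.

Lemma ip_ge0 x : 0 <= ip x x.
Proof. by apply: sumr_ge0 => i _; rewrite -expr2 sqr_ge0. Qed.

Lemma ip_vec_ge0 m m' : 0 <= ip (vec m) (vec m').
Proof. by apply: sumr_ge0 => i _; rewrite /vec; lia. Qed.

Lemma ip_vecD w m m' : ip w (vec (m + m')%MM) = ip w (vec m) + ip w (vec m').
Proof.
by rewrite -big_split; apply: eq_bigr => i _; rewrite /vec mnmDE PoszD /=; ring.
Qed.

Lemma ip_vec0 w : ip w (vec 0%MM) = 0.
Proof. by apply: big1 => i _; rewrite /vec mnm0E mulr0. Qed.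

Lemma ip_vecMn w m k : ip w (vec (m *+ k)%MM) = k%:Z * ip w (vec m).
Proof.
by rewrite mulr_sumr; apply: eq_bigr => i _; rewrite /vec mulmnE PoszM; ring.
Qed.

Lemma ipDD x y :
  ip (fun i => x i + y i) (fun i => x i + y i) = ip x x + 2 * ip x y + ip y y.
Proof.
by rewrite /ip mulr_sumr -!big_split; apply: eq_bigr => i _ /=; ring.
Qed.

Lemma ip_combr (a b : int) w x y :
  ip w (fun i => a * x i - b * y i) = a * ip w x - b * ip w y.
Proof.
by rewrite /ip !mulr_sumr -sumrB; apply: eq_bigr => i _ /=; ring.
Qed.

Lemma ip_comb (a b : int) x y :
  ip (fun i => a * x i - b * y i) (fun i => a * x i - b * y i) =
  a ^+ 2 * ip x x - 2 * a * b * ip x y + b ^+ 2 * ip y y.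
Proof.
rewrite /ip !mulr_sumr -sumrB -big_split; apply: eq_bigr => i _ /=; ring.
Qed.

(** Each coordinate satisfies [m i * m i <= m i * d]. Summing gives total degree times individual
    degree, which is where the product [D * d] in the final exponent comes from. *)
Lemma ip_vec_le_deg m (d : nat) : (forall i, m i <= d)%N ->
  ip (vec m) (vec m) <= (mdeg m * d)%:Z.
Proof.
move=> md; rewrite mdegE big_distrl /= (big_morph Posz PoszD (erefl _)).
by apply: ler_sum => i _; rewrite /vec; have := md i; nia.
Qed.

End InnerProduct.

Section LatticePoints.
Variables (n : nat) (V : seq 'X_{1..n}) (K i e k : nat).
Hypothesis normV : forall v, v \in V -> ip (vec v) (vec v) <= K%:Z.
Hypotheses (e_gt0 : (0 < e)%N) (le_ie : (i <= e)%N) (lt_Kk : (8 * K < k)%N).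

(* [m] lies in the dilation of the convex hull of [V] by the factor [i / e]. *)
Definition in_hull m :=
  forall w, exists2 v, v \in V & i%:Z * ip w (vec v) <= e%:Z * ip w (vec m).

(** Up to the factor [size t], this is [i] times the average of the chosen vertices minus [e] times
    [m]; clearing denominators keeps everything over the integers. *)
Let defect (t : seq 'I_(size V)) m : 'I_n -> int := fun j =>
  \sum_(l <- t) (i%:Z * vec (nth 0%MM V l) j - e%:Z * vec m j).

(* Greedy approximate Caratheodory: the next vertex is chosen in the half-space
   opposite to the current error. *)
Lemma approx_caratheodory m h : in_hull m -> exists t : h.-tuple 'I_(size V),
  ip (defect t m) (defect t m) <= (2 * h * (i ^ 2 * K))%:Z.
Proof.
move=> hm.
(* The functional [- m] yields a vertex [v] with [e * <m, m> <= i * <m, v>]; expanding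
   [|i v - e m|^2 >= 0] then bounds the norm of [e m] by that of the scaled vertices. *)
have bm : e%:Z ^+ 2 * ip (vec m) (vec m) <= (i ^ 2 * K)%:Z.
  have [v vV] := hm (fun j => - vec m j).
  have ipN x : ip (fun j => - vec m j) x = - ip (vec m) x.
    by rewrite /ip -sumrN; apply: eq_bigr => j _; rewrite mulNr.
  rewrite !ipN => le1.
  have := ip_ge0 (fun j => i%:Z * vec v j - e%:Z * vec m j).
  rewrite ip_comb; have := normV vV.
  have -> : ip (vec v) (vec m) = ip (vec m) (vec v).
    by apply: eq_bigr => j _; rewrite mulrC.
  move: (ip (vec m) (vec v)) (ip _ _) (ip _ _) le1 => a b c; nia.
elim: h => [|h [t IH]].
  exists [tuple]; rewrite /ip big1 // => j _.
  by rewrite /defect big_nil mul0r.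
(* Using the current error as functional makes the cross term nonpositive, so the squared error
   grows by at most [|i v - e m|^2]. This is at most [2 * i ^ 2 * K], because exponent vectors have
   nonnegative inner product. *)
have [v vV le1] := hm (defect t m).
have vi : (index v V < size V)%N by rewrite index_mem.
exists [tuple of Ordinal vi :: t].
set x := defect t m in IH le1 *.
have E j : defect [tuple of Ordinal vi :: t] m j =
   x j + (i%:Z * vec v j - e%:Z * vec m j).
  by rewrite /defect /= big_cons nth_index // addrC.
rewrite /ip; under eq_bigr do rewrite E.
rewrite -/(ip _ _) (ipDD x) ip_combr ip_comb.
have := ip_vec_ge0 v m; have := normV vV.
move: (ip x x) (ip x (vec v)) (ip x (vec m)) (ip _ _) (ip _ _) (ip _ _) IH le1 bm.
move=> a b c f g l; nia.
Qed.

(** The two defects differ by [e * k * (m' - m)], so [(e * k) ^ 2 * |m' - m| ^ 2 <= 8 * k * i ^ 2 *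
    K < (e * k) ^ 2]. The integer [|m' - m| ^ 2] is therefore 0. *)
Lemma hull_approx_inj m m' (t : k.-tuple 'I_(size V)) :
  ip (defect t m) (defect t m) <= (2 * k * (i ^ 2 * K))%:Z ->
  ip (defect t m') (defect t m') <= (2 * k * (i ^ 2 * K))%:Z -> m = m'.
Proof.
move=> le1 le2.
pose d := fun j => vec m' j - vec m j.
have E j : defect t m j - defect t m' j = e%:Z * k%:Z * d j.
  rewrite /defect -sumrB /d.
  rewrite (eq_bigr (fun=> e%:Z * (vec m' j - vec m j))) => [|l _]; last by ring.
  rewrite big_const_seq count_predT size_tuple iter_addr_0 -mulr_natr natz.
  by ring.
have E2 : (e%:Z * k%:Z) ^+ 2 * ip d d <=
    2 * ip (defect t m) (defect t m) + 2 * ip (defect t m') (defect t m').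
  rewrite /ip !mulr_sumr -big_split; apply: ler_sum => j _ /=.
  have -> : (e%:Z * k%:Z) ^+ 2 * (d j * d j) = (e%:Z * k%:Z * d j) ^+ 2 by ring.
  rewrite -E; move: (defect t m j) (defect t m' j) => a b.
  have := sqr_ge0 (a + b); nia.
have d0 : ip d d = 0.
  have d_ge0 := ip_ge0 d.
  apply/eqP; case: ltrgtP d_ge0 => // d_gt0 _.
  have lt1 : (8 * (i ^ 2 * K) * k < (e * k) ^ 2)%N.
    have le_ie2 : (i ^ 2 <= e ^ 2)%N by rewrite leq_exp2r.
    have e2_gt0 : (0 < e ^ 2)%N by rewrite expn_gt0 e_gt0.
    have lt_ik : (i ^ 2 * (8 * K) < e ^ 2 * k)%N.
      by apply: leq_ltn_trans (leq_mul le_ie2 (leqnn _)) _; rewrite ltn_pmul2l.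
    by rewrite expnMn; nia.
  have : (e%:Z * k%:Z) ^+ 2 <= (8 * (i ^ 2 * K) * k)%:Z.
    apply: le_trans (_ : (e%:Z * k%:Z) ^+ 2 * ip d d <= _).
      by rewrite ler_peMr ?sqr_ge0.
    lia.
  have : (e%:Z * k%:Z) ^+ 2 = ((e * k) ^ 2)%N%:Z by rewrite PoszM; lia.
  lia.
apply/mnmP => j; move: d0 => /eqP; rewrite psumr_eq0; last first.
  by move=> l _; rewrite -expr2 sqr_ge0.
move/allP/(_ j (mem_index_enum j)); rewrite /= mulf_eq0 orbb subr_eq0 /vec.
by move=> /eqP; lia.
Qed.

(** A point of the dilated hull is determined by any [k]-tuple of vertices approximating it, and
    there are [size V ^ k] such tuples. *)
Lemma hull_card (A : seq 'X_{1..n}) : uniq A ->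
  {in A, forall m, in_hull m} -> (size A <= size V ^ k)%N.
Proof.
move=> uA hA.
pose P m (t : k.-tuple 'I_(size V)) :=
  ip (defect t m) (defect t m) <= (2 * k * (i ^ 2 * K))%:Z.
case: (altP (A =P [::])) => [->//|A0].
have [m0 m0A] : exists m, m \in A.
  by case: (A) A0 => // m0 ? _; exists m0; rewrite inE eqxx.
have [t0 _] := approx_caratheodory k (hA _ m0A).
(* The default [t0] is never reached on [A], where an approximating tuple always exists. *)
pose c m := odflt t0 [pick t | P m t].
have cP m : m \in A -> P m (c m).
  move=> mA; rewrite /c; case: pickP => //= noP.
  by have [t Pt] := approx_caratheodory k (hA _ mA); move: (noP t); rewrite /P Pt.
have inj : {in A &, injective c}.
  move=> m m' mA m'A eqc; apply: (@hull_approx_inj _ _ (c m)); first exact: cP.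
  by rewrite eqc; apply: cP.
rewrite -(size_map c) -[size V in X in (_ <= X)%N]card_ord -card_tuple.
have /card_uniqP <- : uniq (map c A) by rewrite map_inj_in_uniq.
exact: max_card.
Qed.

End LatticePoints.

(** * Sparsity of the powers of a part of a root *)

Lemma seq_min (T : eqType) (le : rel T) (s : seq T) x :
  total le -> transitive le -> x \in s ->
  exists2 y, y \in s & {in s, forall z, le y z}.
Proof.
move=> le_total le_trans.
case E: (sort le s) => [|y s'] xs.
  by rewrite -(mem_sort le) E in xs.
have := sort_sorted le_total s; rewrite E /= => /(order_path_min le_trans) /allP ys'.
exists y; first by rewrite -(mem_sort le) E inE eqxx.
move=> z; rewrite -(mem_sort le) E inE => /orP[/eqP->|/ys' //].
by case/orP: (le_total y y).
Qed.

Section WeightedInitialTerm.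
Variables (n : nat) (F : fieldType) (w : 'I_n -> int).
Implicit Types (p q g : {mpoly F[n]}) (m : 'X_{1..n}).

(** The weight [w] may have entries of any sign and may have ties; breaking them by the monomial
    order singles out one exponent, so that initial exponents add under products. *)
Definition initial p m :=
  m \in msupp p /\
  forall m', m' \in msupp p ->
    ip w (vec m) <= ip w (vec m') /\
    (ip w (vec m') = ip w (vec m) -> (m <= m')%O).

Lemma initial_exists p m : m \in msupp p -> exists m0, initial p m0.
Proof.
move=> mp.
have [m1 m1p min1] : exists2 m1, m1 \in msupp p &
    {in msupp p, forall m', ip w (vec m1) <= ip w (vec m')}.
  apply: (seq_min _ _ mp) => [a b|a b c]; [exact: le_total|exact: le_trans].
pose s := [seq m' <- msupp p | ip w (vec m') == ip w (vec m1)].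
have [m0] : exists2 m0, m0 \in s & {in s, forall m', (m0 <= m')%O}.
  apply: (@seq_min _ _ _ m1) => [a b|a b c|].
  - exact: le_total.
  - exact: le_trans.
  - by rewrite mem_filter eqxx.
rewrite mem_filter => /andP[/eqP em0 m0p] min0; exists m0; split=> // m' m'p.
rewrite em0; split=> [|em']; first exact: min1.
by apply: min0; rewrite mem_filter em' eqxx.
Qed.

Lemma initialM p q a b : initial p a -> initial q b -> initial (p * q) (a + b)%MM.
Proof.
move=> [ap mina] [bq minb]; split; last first.
  move=> _ /msuppM_le /allpairsP[[a' b'] /= [a'p b'q ->]].
  have [la ea] := mina _ a'p; have [lb eb] := minb _ b'q.
  rewrite !ip_vecD; split=> [|eab]; first by lia.
  by apply: lem_add; [apply: ea|apply: eb]; lia.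
(* With the initial term of [p] split off, the rest contributes nothing at the exponent [a + b]:
   another pair with this sum would violate minimality of the weights or of the tie-break. *)
have -> : p = (p - p@_a *: 'X_[a]) + p@_a *: 'X_[a] by rewrite subrK.
rewrite mcoeff_msupp mulrDl mcoeffD -scalerAl mcoeffZ.
rewrite [X in _ + p@_a * X@__]mulrC mcoeffMX.
rewrite [X in X + _]memN_msupp_eq0 ?add0r.
  by rewrite mulf_neq0 // -mcoeff_msupp.
apply/negP; rewrite mulrC => /msuppM_le /allpairsP[[b' a'] /= []] b'q.
rewrite (perm_mem (msupp_rem _ _)) mem_rem_uniq // inE => /andP[na a'p].
rewrite [RHS]addmC => eab; have [la ea] := mina _ a'p; have [lb eb] := minb _ b'q.
have := congr1 (fun m => ip w (vec m)) eab; rewrite !ip_vecD => eip.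
have {}ea : (a < a')%O by rewrite lt_neqAle eq_sym na ea //; lia.
have {}eb : (b <= b')%O by apply: eb; lia.
by have := ltmc_le_add ea eb; rewrite eab ltxx.
Qed.

Lemma initialX p a k : initial p a -> initial (p ^+ k) (a *+ k)%MM.
Proof.
move=> pa; elim: k => [|k IH]; last by rewrite exprS mulmS; apply: initialM.
rewrite expr0 mulm0n; split=> [|m']; first by rewrite msupp1 inE.
by rewrite msupp1 inE => /eqP ->.
Qed.

(** If [m0] is the initial exponent of [g], then [m0 *+ e] survives in [g ^+ e], while every
    exponent of [h ^+ i] is a sum of [i] exponents of [g] and so weighs at least [i] times [m0]. *)
Lemma power_weight (h g : {mpoly F[n]}) e m i : g != 0 ->
  {subset msupp h <= msupp g} -> m \in msupp (h ^+ i) ->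
  exists2 v, v \in msupp (g ^+ e) & i%:Z * ip w (vec v) <= e%:Z * ip w (vec m).
Proof.
move=> /mlead_supp /initial_exists [m0 m0g] sub mi.
have [m0e _] := initialX e m0g; exists (m0 *+ e)%MM => //.
suff : i%:Z * ip w (vec m0) <= ip w (vec m) by rewrite ip_vecMn; nia.
case: m0g => _ min0; elim: i m mi => [|i IH] m.
  by rewrite expr0 msupp1 inE => /eqP ->; rewrite ip_vec0 mul0r.
rewrite exprS => /msuppM_le /allpairsP[[a b] /= [ah bi ->]].
have [le1 _] := min0 _ (sub _ ah); have := IH _ bi.
by rewrite ip_vecD; lia.
Qed.

End WeightedInitialTerm.

Lemma mdeg_le_tdeg n (F : fieldType) (f : {mpoly F[n]}) m :
  m \in msupp f -> (mdeg m <= tdeg f)%N.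
Proof. by move=> /msize_mdeg_lt; rewrite /tdeg; lia. Qed.

Lemma mnm_le_indeg n (F : fieldType) (f : {mpoly F[n]}) m j :
  m \in msupp f -> (m j <= indeg f)%N.
Proof.
move=> mf; rewrite /indeg (big_rem m) //=.
apply: leq_trans (leq_maxl _ _); exact: (leq_bigmax (F := fun i => m i) j).
Qed.

(** The exponents of [h ^+ i] lie in the hull of the support of [f] dilated by [i / e], so the
    lattice point count applies with [K] equal to [tdeg f * indeg f]. *)
Lemma root_power_sparsity n (F : fieldType) (f g h : {mpoly F[n]}) e i k :
  f != 0 -> g ^+ e = f -> {subset msupp h <= msupp g} ->
  (0 < e)%N -> (i <= e)%N -> (8 * (tdeg f * indeg f) < k)%N ->
  (sparsity (h ^+ i) <= sparsity f ^ k)%N.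
Proof.
move=> f0 gef sub e0 ie lt_k.
apply: (@hull_card _ _ (tdeg f * indeg f) i e) => // [v vf|m mi w].
- apply: le_trans (ip_vec_le_deg (d := indeg f) _) _ => [j|].
    exact: mnm_le_indeg vf.
  by rewrite lez_nat leq_mul2r mdeg_le_tdeg ?orbT.

- rewrite -gef; apply: power_weight sub mi.
  by apply: contraNneq f0 => g0; rewrite -gef g0 expr0n; case: (e) e0.
Qed.

(** * Leading terms *)

Section LeadingPart.
Variables (n : nat) (F : fieldType).
Implicit Types (p g h r : {mpoly F[n]}) (m : 'X_{1..n}).

Lemma mlead_eq p m : (mlead p <= m)%O -> p@_m != 0 -> mlead p = m.
Proof.
move=> le1; rewrite -mcoeff_msupp => /msupp_le_mlead le2.
by apply/eqP; rewrite eq_le le1.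
Qed.

Definition dominates h r :=
  forall a b, a \in msupp h -> b \in msupp r -> (b < a)%O.

(** Nothing cancels between the two parts. Hence each partial root is supported inside the root, as
    the sparsity bound requires. *)
Lemma dominates_sub h r : dominates h r -> {subset msupp h <= msupp (h + r)}.
Proof.
move=> dom a ah; rewrite mcoeff_msupp mcoeffD.
rewrite [r@_a]memN_msupp_eq0 ?addr0 -?mcoeff_msupp //.
by apply/negP => ar; have := dom _ _ ah ar; rewrite ltxx.
Qed.

Lemma dominates_lead g :
  dominates (mleadc g *: 'X_[mlead g]) (g - mleadc g *: 'X_[mlead g]).
Proof.
move=> a b /msuppZ_le; rewrite msuppX inE => /eqP ->.
rewrite (perm_mem (msupp_rem _ _)) mem_rem_uniq // inE => /andP[na bg].
by rewrite lt_neqAle na msupp_le_mlead.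
Qed.

Lemma dominates_step h r (t := mleadc r *: 'X_[mlead r]) : r != 0 ->
  dominates h r -> dominates (h + t) (r - t).
Proof.
move=> r0 dom a b /msuppD_le; rewrite mem_cat => ah.
rewrite (perm_mem (msupp_rem _ _)) mem_rem_uniq // inE => /andP[na br].
have lb : (b < mlead r)%O by rewrite lt_neqAle na msupp_le_mlead.
case/orP: ah => [ah|/msuppZ_le]; last by rewrite msuppX inE => /eqP ->.
exact: dom.
Qed.

Lemma sparsity_sub_lead r : r != 0 ->
  sparsity (r - mleadc r *: 'X_[mlead r]) = (sparsity r).-1.
Proof.
by move=> r0; rewrite /sparsity (perm_size (msupp_rem _ _)) size_rem ?mlead_supp.
Qed.

Lemma mlead_exp_monic p k : mleadc p = 1 ->
  (mlead (p ^+ k) <= (mlead p *+ k)%MM)%O /\ (p ^+ k)@_(mlead p *+ k)%MM = 1.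
Proof. by move=> p1; rewrite mleadX_le mleadcX p1 expr1n. Qed.

(** Factor [g ^+ q - h ^+ q] as [r] times the sum of the [g ^+ (q.-1 - i) * h ^+ i]. The [q]
    summands are monic with the same leading monomial, so their sum has leading coefficient [q],
    which is nonzero in [F]. *)
Lemma lead_pow_diff h r q (g := h + r) (m := (mlead h *+ q.-1 + mlead r)%MM) :
  mleadc h = 1 -> r != 0 -> dominates h r -> (0 < q)%N -> q%:R != 0 :> F ->
  mlead (g ^+ q - h ^+ q) = m /\ mleadc (g ^+ q - h ^+ q) = q%:R * mleadc r.
Proof.
move=> h1 r0 dom q0 qF0.
have h0 : h != 0.
  by apply/eqP => h0; move: h1; rewrite h0 mleadc0 => /esym/eqP; rewrite oner_eq0.
have lt_rh : (mlead r < mlead h)%O by apply: dom; apply: mlead_supp.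
have lg : mlead g = mlead h by rewrite /g mleadDl.
have g1 : mleadc g = 1.
  by rewrite lg /g mcoeffD h1 [r@__]mcoeff_gt_mlead ?addr0.
pose S := \sum_(i < q) g ^+ (q.-1 - i) * h ^+ i.
have lS i : (i < q)%N -> (mlead (g ^+ (q.-1 - i) * h ^+ i) <= (mlead h *+ q.-1)%MM)%O
   /\ (g ^+ (q.-1 - i) * h ^+ i)@_(mlead h *+ q.-1)%MM = 1.
  move=> iq; have [] := mlead_exp_monic (q.-1 - i) g1; rewrite lg => l1 c1.
  have [l2 c2] := mlead_exp_monic i h1.
  have -> : (mlead h *+ q.-1)%MM = (mlead h *+ (q.-1 - i) + mlead h *+ i)%MM.
    by apply/mnmP => j; rewrite mnmDE !mulmnE; nia.
  rewrite mleadcMW // c1 c2 mulr1; split=> //.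
  by apply: le_trans (mleadM_le _ _) _; apply: lem_add.
have lS' : (mlead S <= (mlead h *+ q.-1)%MM)%O.
  apply: le_trans (mlead_sum_le _ _ _) _.
  by apply/joinsP => i _; apply: (lS _ _).1.
have cS : S@_(mlead h *+ q.-1)%MM = q%:R.
  rewrite /S raddf_sum (eq_bigr (fun=> 1)) => [|i _]; last exact: (lS _ _).2.
  by rewrite sumr_const card_ord.
have E : g ^+ q - h ^+ q = S * r by rewrite subrXX [g - h]addrAC subrr add0r mulrC.
have c : (g ^+ q - h ^+ q)@_m = q%:R * mleadc r by rewrite E mleadcMW // cS.
have lm : mlead (g ^+ q - h ^+ q) = m.
  apply: mlead_eq; last by rewrite c mulf_neq0 // mleadc_eq0.
  by rewrite E; apply: le_trans (mleadM_le _ _) _; apply: lem_add.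
by rewrite lm.
Qed.

End LeadingPart.

(** * Term lists and Frobenius roots *)

Section TermLists.
Variables (n : nat) (F : fieldType).
Implicit Types (p : {mpoly F[n]}) (L : seq (F * 'X_{1..n})) (m : 'X_{1..n}).

Definition den L : {mpoly F[n]} := \sum_(t <- L) t.1 *: 'X_[t.2].

(** The order of the terms is left free, so this is [sparse_repr] expressed on lists; it also forces
    [size L] to be the sparsity of [p]. *)
Definition represents L p :=
  [/\ uniq (unzip2 L), all (fun t => t.1 != 0) L & den L = p].

Lemma den_cons t L : den (t :: L) = t.1 *: 'X_[t.2] + den L.
Proof. by rewrite /den big_cons. Qed.

Lemma mcoeff_den_notin L m : m \notin unzip2 L -> (den L)@_m = 0.
Proof.
elim: L => [|t L IH]; first by rewrite /den big_nil mcoeff0.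
rewrite /= inE negb_or => /andP[nm mL].
by rewrite den_cons mcoeffD mcoeffZ mcoeffX eq_sym (negbTE nm) mulr0 add0r IH.
Qed.

Lemma mcoeff_den L t : uniq (unzip2 L) -> t \in L -> (den L)@_t.2 = t.1.
Proof.
elim: L => [//|t' L IH] /= /andP[nt' uL]; rewrite den_cons mcoeffD mcoeffZ mcoeffX.
rewrite inE => /orP[/eqP ->|tL].
  by rewrite eqxx mulr1 mcoeff_den_notin ?addr0.
case: eqP => [et|_]; last by rewrite mulr0 add0r IH.
by case/negP: nt'; rewrite et; apply: map_f.
Qed.

Lemma represents_coeff L p t : represents L p -> t \in L -> p@_t.2 = t.1.
Proof. by case=> uL _ <-; apply: mcoeff_den. Qed.

Lemma represents_msupp L p : represents L p -> msupp p =i unzip2 L.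
Proof.
move=> rL m; rewrite mcoeff_msupp; case: (rL) => uL /allP nz eL.
apply/idP/idP => [|/mapP[t tL ->]]; last by rewrite (represents_coeff rL) ?nz.
by apply: contraR => /mcoeff_den_notin; rewrite eL => /eqP.
Qed.

Lemma represents_size L p : represents L p -> size L = sparsity p.
Proof.
move=> rL; case: (rL) => uL _ _; rewrite -(size_map snd).
by apply/perm_size/uniq_perm => // m; rewrite (represents_msupp rL).
Qed.

Lemma representsP L p : represents L p <-> perm_eq L [seq (p@_m, m) | m <- msupp p].
Proof.
split=> [rL|pL].
  case: (rL) => uL _ _; apply: uniq_perm.
  - exact: map_uniq uL.
  - by rewrite map_inj_uniq ?msupp_uniq // => m m' [].
  move=> [c m]; apply/idP/mapP => [tL|[m' m'p [-> ->]]].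
    exists m; last by rewrite (represents_coeff rL tL : p@_m = c).
    by rewrite (represents_msupp rL); apply/mapP; exists (c, m).
  move: (m'p); rewrite (represents_msupp rL) => /mapP[[c' m1] tL e1].
  by rewrite /= in e1; rewrite e1 (represents_coeff rL tL : p@_m1 = c').
split.
- rewrite (perm_uniq (perm_map snd pL)) -map_comp map_id_in ?msupp_uniq //.
- rewrite (perm_all _ pL); apply/allP => t /mapP[m mp -> /=].
  by rewrite -mcoeff_msupp.
- by rewrite /den (perm_big _ pL) big_map -mpolyE.
Qed.

Lemma represents_perm L L' p : perm_eq L L' -> represents L p -> represents L' p.
Proof.
by move=> pLL /representsP pL; apply/representsP; rewrite -(permPl pLL).
Qed.

Lemma sparse_reprP p v :
  sparse_repr p v <-> exists2 L, represents L p & v = encode_terms L.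
Proof. by split=> -[L /representsP rL ->]; exists L. Qed.

Lemma represents_nil L : represents L 0 <-> L = [::].
Proof.
split=> [/represents_size|->]; last by split; rewrite // /den big_nil.
by rewrite /sparsity msupp0 => /size0nil.
Qed.

(** Functional model of [add_term_cmd]; the reversal reflects that the loop conses the surviving
    terms onto a new list. *)
Definition add_term L (t : F * 'X_{1..n}) :=
  let c := \sum_(u <- L | u.2 == t.2) u.1 + t.1 in
  let L' := rev [seq u <- L | u.2 != t.2] in
  if c == 0 then L' else (c, t.2) :: L'.

Lemma den_rev L : den (rev L) = den L.
Proof. by rewrite /den (perm_big _ (permEl (perm_rev L))). Qed.

Lemma add_term_represents L t p :
  represents L p -> represents (add_term L t) (p + t.1 *: 'X_[t.2]).
Proof.
move=> [uL nz <-]; rewrite /add_term; set c := _ + _; set L' := rev _.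
have dL' : c *: 'X_[t.2] + den L' = den L + t.1 *: 'X_[t.2].
  rewrite /L' den_rev /c scalerDl [in RHS]/den.
  rewrite [in RHS](bigID (fun u => u.2 == t.2)) /= {1}/den big_filter scaler_suml.
  rewrite -!addrA; congr (_ + _); last by rewrite addrC.
  by apply: eq_bigr => u /eqP ->.
have nL' : t.2 \notin unzip2 L'.
  by apply/mapP => -[u]; rewrite mem_rev mem_filter => /andP[/eqP ne _] /esym.
have uL' : uniq (unzip2 L').
  rewrite /L' /unzip2 map_rev rev_uniq; apply: subseq_uniq uL.
  exact: map_subseq (filter_subseq _ _).
have nzL' : all (fun u => u.1 != 0) L'.
  by rewrite all_rev; apply/allP => u; rewrite mem_filter => /andP[_ /(allP nz)].
case: eqP => [c0|/eqP c0]; split=> //=; rewrite ?uL' ?nL' ?c0 ?nzL' //.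
  by rewrite -dL' c0 scale0r add0r.
by rewrite den_cons.
Qed.

Lemma size_add_term L t : (size (add_term L t) <= (size L).+1)%N.
Proof.
rewrite /add_term; case: ifP => _ /=; rewrite size_rev size_filter.
  by apply: leq_trans (count_size _ _) _.
exact: count_size.
Qed.

End TermLists.

Lemma mdvd_divK n (m : 'X_{1..n}) (k : nat) :
  (forall i, k %| m i)%N -> (mnm_div m k *+ k)%MM = m.
Proof. by move=> km; apply/mnmP => i; rewrite mulmnE mnmE divnK. Qed.

Section FrobeniusRoots.
Variables (n : nat) (F : fieldType).
Implicit Types (p f g : {mpoly F[n]}) (m : 'X_{1..n}).

(** The condition [[pchar F].-nat P] means that [P] is a power of the characteristic, or 1 in
    characteristic 0, so both cases are treated together. *)
Lemma mpoly_pchar_nat P : [pchar F].-nat P -> [pchar {mpoly F[n]}].-nat P.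
Proof. by rewrite (eq_pnat _ (pchar_lalg _)). Qed.

Lemma expr_pchar_sum P (I : Type) (s : seq I) (G : I -> {mpoly F[n]}) :
  [pchar F].-nat P -> (\sum_(i <- s) G i) ^+ P = \sum_(i <- s) G i ^+ P.
Proof.
move=> cP; have P0 : (0 < P)%N by case/andP: cP.
elim: s => [|i s IH]; first by rewrite !big_nil expr0n; case: (P) P0.
by rewrite !big_cons exprDn_pchar ?IH // mpoly_pchar_nat.
Qed.

Lemma den_expr_pchar P (L : seq (F * 'X_{1..n})) : [pchar F].-nat P ->
  den L ^+ P = den [seq (t.1 ^+ P, (t.2 *+ P)%MM) | t <- L].
Proof.
move=> cP; rewrite /den expr_pchar_sum // big_map.
by apply: eq_bigr => t _; rewrite exprZn mpolyXn.
Qed.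

(** The power [P] is additive, so equal powers give [(p - q) ^+ P = 0], and polynomials over a field
    form a domain. *)
Lemma expr_pchar_inj P : [pchar F].-nat P ->
  injective (fun p : {mpoly F[n]} => p ^+ P).
Proof.
move=> cP p q /= epq; apply/eqP; rewrite -subr_eq0.
have cP' := mpoly_pchar_nat cP.
have /eqP := exprDn_pchar p (- q) cP'.
rewrite exprNn_pchar // epq subrr expf_eq0.
by case/andP.
Qed.

(** Raising to the power [P] acts on each term separately, so roots may be taken separately too;
    distinct multiples of [P] have distinct quotients, so no exponent is repeated. *)
Lemma represents_frob_root P (L G : seq (F * 'X_{1..n})) f (c : F)
    (r : F * 'X_{1..n} -> F) :
  [pchar F].-nat P -> c != 0 -> represents L f ->
  (forall t, t \in L -> (forall i, P %| t.2 i)%N /\ r t ^+ P = t.1 / c) ->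
  G = [seq (r t, mnm_div t.2 P) | t <- L] ->
  represents G (den G) /\ den G ^+ P = c^-1 *: f.
Proof.
move=> cP c0 [uL /allP nz <-] rP ->.
have P0 : (0 < P)%N by case/andP: cP.
have E : [seq (t.1 ^+ P, (t.2 *+ P)%MM) | t <- [seq (r t, mnm_div t.2 P) | t <- L]] =
    [seq (t.1 / c, t.2) | t <- L].
  rewrite -map_comp; apply/eq_in_map => t /rP[dt rt] /=.
  by rewrite rt mdvd_divK.
rewrite den_expr_pchar // E; split; first split=> //.
- have -> : unzip2 [seq (r t, mnm_div t.2 P) | t <- L] =
      [seq mnm_div m P | m <- unzip2 L] by rewrite /unzip2 -!map_comp.
  rewrite map_inj_in_uniq // => _ _ /mapP[t tL ->] /mapP[u uL' ->] etu.
  have [dt _] := rP _ tL; have [du _] := rP _ uL'.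
  by rewrite -(mdvd_divK dt) -(mdvd_divK du) etu.
- apply/allP => _ /mapP[t tL ->] /=; have [_ rt] := rP _ tL.
  apply/eqP => r0; move/eqP: rt; rewrite r0 expr0n gtn_eqF // eq_sym.
  by rewrite mulf_eq0 invr_eq0 (negbTE c0) (negbTE (nz _ tL)).
- rewrite /den big_map scaler_sumr; apply: eq_bigr => t _ /=.
  by rewrite scalerA mulrC.
Qed.

(** Converse direction: multiplying exponents by [P] is injective, so the terms of [g ^+ P] do not
    merge and each term of [f / c] is the [P]-th power of one term of [g]. *)
Lemma frob_root_terms P (L : seq (F * 'X_{1..n})) f g (c : F) t :
  [pchar F].-nat P -> c != 0 -> represents L f -> g ^+ P = c^-1 *: f -> t \in L ->
  (forall i, P %| t.2 i)%N /\ exists b, b ^+ P = t.1 / c.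
Proof.
move=> cP c0 rL egf tL.
have P0 : (0 < P)%N by case/andP: cP.
pose G := [seq (g@_m, m) | m <- msupp g].
have rG : represents G g by apply/representsP.
have ft : (g ^+ P)@_t.2 = t.1 / c by rewrite egf mcoeffZ (represents_coeff rL) // mulrC.
have t0 : t.1 / c != 0.
  by rewrite mulf_neq0 ?invr_eq0 //; case: rL => _ /allP ->.
have [_ _ dG] := rG; move: ft; rewrite -{1}dG den_expr_pchar // => ft.
have : t.2 \in unzip2 [seq (t.1 ^+ P, (t.2 *+ P)%MM) | t <- G].
  by apply: contraNT t0 => /mcoeff_den_notin; rewrite ft => ->.
move=> /mapP[u uG eu]; rewrite eu in ft *.
rewrite mcoeff_den // in ft; last first.
  have -> : unzip2 [seq (t.1 ^+ P, (t.2 *+ P)%MM) | t <- G] =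
      [seq (m *+ P)%MM | m <- unzip2 G] by rewrite /unzip2 -!map_comp.
  rewrite map_inj_uniq; first by case: rG.
  move=> a b /mnmP eab; apply/mnmP => i; have := eab i; rewrite !mulmnE.
  by move=> /eqP; rewrite eqn_pmul2r // => /eqP.
move: uG => /mapP[u' _ uE]; split=> [i|]; first by rewrite uE /= mulmnE dvdn_mull.
by exists u'.1; rewrite -ft uE.
Qed.

End FrobeniusRoots.

(** * The characteristic part of an exponent *)

Lemma pchar_part (F : fieldType) (e P : nat) : (0 < e)%N ->
  (P %| e)%N -> (e %/ P)%:R != 0 :> F ->
  (forall j, (0 < j)%N -> (j %| e)%N -> (e %/ j)%:R != 0 :> F -> (P <= j)%N) ->
  P = (e`_[pchar F])%N.
Proof.
move=> e0 Pe; rewrite natf_neq0_pchar => qP minP.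
have P0 : (0 < P)%N by apply: dvdn_gt0 Pe.
apply/eqP; rewrite eqn_leq; apply/andP; split.
  apply: minP; rewrite ?part_gt0 ?dvdn_part // natf_neq0_pchar.
  by rewrite -{1}(partnC [pchar F] e0) mulKn ?part_pnat.
rewrite -{1}(divnK Pe) partnM //; last by rewrite divn_gt0 // dvdn_leq.
by rewrite part_p'nat // mul1n dvdn_leq // dvdn_part.
Qed.

(** A nontrivial part supplies a prime [p] that is the characteristic and divides [e], exactly the
    situation in which [scalar_frob] is specified. *)
Lemma scalar_frob_part (F : fieldType) (O : scalar_roots F) (e : nat) (a : F) :
  (0 < e)%N -> (1 < e`_[pchar F])%N ->
  root_spec (e`_[pchar F])%N a (scalar_frob O e a).
Proof.
move=> e0 P1.
have [p pr_p pP] : exists2 p, prime p & (p %| (e`_[pchar F])%N)%N.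
  by exists (pdiv (e`_[pchar F])%N); rewrite ?pdiv_prime ?pdiv_dvd.
have cp : p \in [pchar F].
  by apply: (pnatPpi (part_pnat _ e)); rewrite mem_primes pr_p pP; lia.
have -> : (e`_[pchar F])%N = (p ^ logn p e)%N.
  by rewrite -p_part; apply: eq_partn => q; rewrite (pcharf_eq cp).
by apply: scalar_frobP => //; apply: dvdn_trans pP (dvdn_part _ _).
Qed.

(** * Total-correctness rules with cost *)

(** Serves as a frame: registers outside this list keep their values, which carries facts across
    commands and loops. *)
Fixpoint mods (c : cmd) : seq nat :=
  match c with
  | Assign x _ | Root x _ _ | Frob x _ _ => [:: x]
  | Seq c1 c2 | If _ c1 c2 => mods c1 ++ mods c2
  | While _ c => mods c
  end.

(* The counter is decremented first: the body sees the values [k - 1], ..., [0]. *)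
Definition For i c :=
  While (Var i) (Seq (Assign i (EOp2 Defs.Sub (Var i) (ENat 1))) c).

Definition ForEach x l c :=
  While (Var l) (Seq (Assign x (EOp1 Hd (Var l))) (Seq (Assign l (EOp1 Tl (Var l))) c)).

Section WeakestPreconditions.
Variables (F : fieldType) (n : nat) (O : scalar_roots F) (R : nat -> nat).
Implicit Types (st : store F n) (c : cmd) (Q : store F n -> nat -> Prop).

Definition agree (xs : seq nat) st st' := forall y, y \notin xs -> st' y = st y.

Lemma agree_trans xs st1 st2 st3 :
  agree xs st1 st2 -> agree xs st2 st3 -> agree xs st1 st3.
Proof. by move=> a12 a23 y ny; rewrite a23 // a12. Qed.

Lemma exec_agree c st st' t : exec O R c st st' t -> agree (mods c) st st'.
Proof.
elim=> {c st st' t}; rewrite /agree /upd //=.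
- by move=> st x E y; rewrite inE => /negbTE ->.
- move=> c1 c2 st0 st1 st2 t1 t2 _ IH1 _ IH2 y.
  by rewrite mem_cat negb_or => /andP[y1 y2]; rewrite IH2 ?IH1.
- by move=> E c1 c2 st st' t _ _ IH y; rewrite mem_cat negb_or => /andP[/IH].
- by move=> E c1 c2 st st' t _ _ IH y; rewrite mem_cat negb_or => /andP[_ /IH].
- by move=> E c st0 st1 st2 t1 t2 _ _ IH1 _ IH2 y ny; rewrite IH2 ?IH1.
- by move=> x E1 E2 st k a _ _ y; rewrite inE => /negbTE ->.
- by move=> x E1 E2 st k a _ _ y; rewrite inE => /negbTE ->.
Qed.

Definition wp c st Q := exists st' t, exec O R c st st' t /\ Q st' t.

Lemma wp_conseq c st Q Q' : wp c st Q ->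
  (forall st' t, agree (mods c) st st' -> Q st' t -> Q' st' t) -> wp c st Q'.
Proof.
move=> [st' [t [ex qt]]] QQ; exists st', t; split=> //.
by apply: QQ => //; apply: exec_agree ex.
Qed.

Lemma wp_assign x E st Q :
  Q (upd st x (eval st E)) (expr_cost E).+1 -> wp (Assign x E) st Q.
Proof. by move=> q; do 2!eexists; split; [apply: ExecAssign|]. Qed.

Lemma wp_seq c1 c2 st Q :
  wp c1 st (fun st1 t1 => wp c2 st1 (fun st2 t2 => Q st2 (t1 + t2)%N)) ->
  wp (Seq c1 c2) st Q.
Proof.
move=> [st1 [t1 [ex1 [st2 [t2 [ex2 q]]]]]].
by do 2!eexists; split; [apply: ExecSeq ex1 ex2|].
Qed.

Lemma wp_if E c1 c2 st Q (Q' := fun st' t => Q st' (expr_cost E + t).+1) :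
  (truth (eval st E) -> wp c1 st Q') ->
  (~~ truth (eval st E) -> wp c2 st Q') -> wp (If E c1 c2) st Q.
Proof.
case: (boolP (truth (eval st E))) => b.
  by case/(_ isT) => st' [t [ex q]] _; do 2!eexists; split; [apply: ExecIfTrue ex|].
by move=> _ /(_ isT) [st' [t [ex q]]]; do 2!eexists; split; [apply: ExecIfFalse ex|].
Qed.

Lemma wp_root x E1 E2 st k a Q :
  eval st E1 = VNat k -> eval st E2 = VScalar a ->
  Q (upd st x (voption n (scalar_root O k a))) (expr_cost E1 + expr_cost E2 + R k).+1 ->
  wp (Root x E1 E2) st Q.
Proof. by move=> e1 e2 q; do 2!eexists; split; [apply: ExecRoot e1 e2|]. Qed.

Lemma wp_frob x E1 E2 st k a Q :
  eval st E1 = VNat k -> eval st E2 = VScalar a ->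
  Q (upd st x (voption n (scalar_frob O k a))) (expr_cost E1 + expr_cost E2 + R k).+1 ->
  wp (Frob x E1 E2) st Q.
Proof. by move=> e1 e2 q; do 2!eexists; split; [apply: ExecFrob e1 e2|]. Qed.

(** The invariant is indexed by the number of iterations still to run. Each iteration adds 6 to the
    cost of the body, for the test and the decrement, and the last test costs 2. *)
Lemma wp_for i c (k : nat) (J : nat -> store F n -> Prop) tb st0 :
  st0 i = VNat k -> i \notin mods c -> J k st0 ->
  (forall j st, (j < k)%N -> agree (i :: mods c) st0 st -> J j.+1 st ->
     wp c (upd st i (VNat j)) (fun st' t => (t <= tb)%N /\ J j st')) ->
  wp (For i c) st0 (fun st' t =>
    [/\ J 0 st', agree (i :: mods c) st0 st' & (t <= k * (tb + 6) + 2)%N]).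
Proof.
move=> ek ni J0 body.
have main j st : (j <= k)%N -> agree (i :: mods c) st0 st ->
    st i = VNat j -> J j st -> wp (For i c) st (fun st' t =>
    [/\ J 0 st', agree (i :: mods c) st0 st' & (t <= j * (tb + 6) + 2)%N]).
  elim: j st => [|j IH] st lej ast ei Jj.
    exists st, 2; split; last by split=> //; lia.
    by apply: ExecWhileFalse; rewrite /= ei.
  have [st1 [t1 [ex1 [le1 J1]]]] := body _ _ lej ast Jj.
  have a1 := exec_agree ex1.
  have a01 : agree (i :: mods c) st0 st1.
    apply: agree_trans ast _ => y; rewrite inE negb_or => /andP[yi /a1 ->].
    by rewrite /upd (negbTE yi).
  have ei1 : st1 i = VNat j by rewrite a1 // /upd eqxx.
  have [st2 [t2 [ex2 [J2 a2 le2]]]] := IH _ (ltnW lej) a01 ei1 J1.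
  do 2!eexists; split; last first.
    split; [exact: J2|exact: a2|].
    2: apply: ExecWhileTrue ex2; first by rewrite /= ei.
    2: apply: ExecSeq ex1; have := ExecAssign O R st i (EOp2 Defs.Sub (Var i) (ENat 1)).
    2: by rewrite /= ei subn1; apply.
  by rewrite /=; nia.
by apply: main.
Qed.

(** The invariant is indexed by the unread suffix of the list. The cost bound may depend on the
    element, because the Frobenius loop spares the leading term an extraction. *)
Lemma wp_foreach x l c (T : Type) (enc : T -> value F n) (ts : seq T)
    (J : seq T -> store F n -> Prop) (tb : T -> nat) st0
    (encs := foldr (fun t v => VCons (enc t) v) VNil) :
  x != l -> st0 l = encs ts -> l \notin mods c -> J ts st0 ->
  (forall t ts' st, agree [:: x, l & mods c] st0 st -> J (t :: ts') st ->
     wp c (upd (upd st x (enc t)) l (encs ts'))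
       (fun st' k => (k <= tb t)%N /\ J ts' st')) ->
  wp (ForEach x l c) st0 (fun st' k =>
    [/\ J [::] st', agree [:: x, l & mods c] st0 st' &
        (k <= \sum_(t <- ts) tb t + 8 * size ts + 2)%N]).
Proof.
move=> xl el nl J0 body.
have main ts' st : agree [:: x, l & mods c] st0 st ->
    st l = encs ts' -> J ts' st -> wp (ForEach x l c) st (fun st' k =>
    [/\ J [::] st', agree [:: x, l & mods c] st0 st' &
        (k <= \sum_(t <- ts') tb t + 8 * size ts' + 2)%N]).
  elim: ts' st => [|t ts' IH] st ast elt Jt.
    exists st, 2; split; last by split=> //; rewrite big_nil.
    by apply: ExecWhileFalse; rewrite /= elt.
  have [st1 [t1 [ex1 [le1 J1]]]] := body _ _ _ ast Jt.
  have a1 := exec_agree ex1.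
  have a01 : agree [:: x, l & mods c] st0 st1.
    apply: agree_trans ast _ => y; rewrite !inE !negb_or => /and3P[yx yl /a1 ->].
    by rewrite /upd (negbTE yx) (negbTE yl).
  have el1 : st1 l = encs ts' by rewrite a1 // /upd eqxx.
  have [st2 [t2 [ex2 [J2 a2 le2]]]] := IH _ a01 el1 J1.
  have exx := ExecAssign O R st x (EOp1 Hd (Var l)); rewrite /= elt /= in exx.
  have exl := ExecAssign O R (upd st x (enc t)) l (EOp1 Tl (Var l)).
  have elx : upd st x (enc t) l = encs (t :: ts').
    by rewrite /upd eq_sym (negbTE xl).
  rewrite /= elx /= in exl.
  do 2!eexists; split; last first.
    split; [exact: J2|exact: a2|].
    2: apply: ExecWhileTrue (ExecSeq exx (ExecSeq exl ex1)) ex2.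
    2: by rewrite /= elt.
  by rewrite big_cons /=; nia.
by apply: main.
Qed.

End WeakestPreconditions.

(** * The program *)

Declare Scope prog_scope.
Local Open Scope prog_scope.
Coercion Var : nat >-> expr.
Notation "x <~ E" := (Assign x E) (at level 70, no associativity) : prog_scope.
Notation "c1 ;; c2" := (Seq c1 c2) (at level 90, right associativity) : prog_scope.
Local Notation Fst E := (EOp1 Hd E).
Local Notation Snd E := (EOp1 Tl E).
Local Notation Pair E1 E2 := (EOp2 Defs.Cons E1 E2).

(* Commands are inlined rather than called, so that the registers are global and
   nested loops need distinct ones; register 9 is a scratch register. *)
Local Notation vN := 1%N. Local Notation vE := 2%N. Local Notation vFL := 3%N.
Local Notation vS := 4%N. Local Notation vLc := 5%N. Local Notation vLm := 6%N.
Local Notation vSt := 7%N. Local Notation vRt := 10%N. Local Notation vMe := 11%N.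
Local Notation vI := 12%N. Local Notation vP := 13%N. Local Notation vQ := 14%N.
Local Notation vXq := 15%N. Local Notation vK := 16%N. Local Notation vQc := 17%N.
Local Notation vX := 18%N. Local Notation vCnt := 19%N. Local Notation vG := 20%N.
Local Notation vOk := 21%N. Local Notation vFl := 22%N. Local Notation vFt := 23%N.
Local Notation vR := 24%N. Local Notation vA := 25%N. Local Notation vMm := 26%N.
Local Notation vD := 27%N. Local Notation vSz := 28%N. Local Notation vDl := 29%N.
Local Notation vDt := 30%N. Local Notation vTd := 31%N. Local Notation vJ := 32%N.
Local Notation vBk := 33%N. Local Notation vB := 35%N. Local Notation vB2 := 36%N.
Local Notation vC3 := 37%N. Local Notation vAcc := 40%N. Local Notation vC1 := 41%N.
Local Notation vM1 := 42%N. Local Notation vL2 := 43%N. Local Notation vT2 := 44%N.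
Local Notation vC := 45%N. Local Notation vM := 46%N. Local Notation vOld := 47%N.
Local Notation vTo := 48%N. Local Notation vNew := 49%N. Local Notation vH := 50%N.
Local Notation vPw := 51%N. Local Notation vPi := 52%N. Local Notation vL1 := 53%N.
Local Notation vT1 := 54%N. Local Notation vLen := 55%N. Local Notation vLl := 56%N.
Local Notation vLt := 57%N. Local Notation vSh := 60%N. Local Notation vIt := 61%N.
Local Notation vM0 := 62%N. Local Notation vCand := 63%N. Local Notation vLC := 64%N.
Local Notation vLM := 65%N.

Definition skip : cmd := 9%N <~ ENil.

(** The initial pair is the leading term of the zero polynomial; the comparison is not strict, so
    that even a constant term replaces it. *)
Definition lead_cmd : cmd :=
  vLc <~ EZero ;; vLm <~ EMon0 ;;
  ForEach vSt vS
    (If (EOp2 Defs.Le vLm (Snd vSt)) (vLc <~ Fst vSt ;; vLm <~ Snd vSt) skip).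

Definition add_term_cmd : cmd :=
  vNew <~ ENil ;; vOld <~ vAcc ;;
  ForEach vTo vOld
    (If (EOp2 Defs.Eq (Snd vTo) vM)
       (vC <~ EOp2 Defs.Add (Fst vTo) vC)
       (vNew <~ Pair vTo vNew)) ;;
  If (EOp2 Defs.Eq vC EZero) (vAcc <~ vNew) (vAcc <~ Pair (Pair vC vM) vNew).

(** The one primitive behind products, differences, term insertion and scaling: [vAcc] gains [vC1]
    times the monomial [vM1] times [vL2]. *)
Definition axpy_cmd : cmd :=
  ForEach vT2 vL2
    (vC <~ EOp2 Defs.Mul vC1 (Fst vT2) ;; vM <~ EOp2 Defs.Add vM1 (Snd vT2) ;;
     add_term_cmd).

Definition mul_cmd : cmd :=
  vL1 <~ vPw ;; vAcc <~ ENil ;;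
  ForEach vT1 vL1 (vC1 <~ Fst vT1 ;; vM1 <~ Snd vT1 ;; vL2 <~ vH ;; axpy_cmd).

(* A product with more than [vB] terms is replaced by 0.  This never happens when
   [vH] is part of a root, and is otherwise harmless because the power is compared
   with [vG], which is nonzero, before anything is output. *)
Definition pow_cmd : cmd :=
  vPw <~ Pair (Pair EOne EMon0) ENil ;; vPi <~ vQ ;;
  For vPi
    (mul_cmd ;; vLen <~ ENat 0 ;; vLl <~ vAcc ;;
     ForEach vLt vLl (vLen <~ EOp2 Defs.Add vLen (ENat 1)) ;;
     If (EOp2 Defs.Le vLen vB) (vPw <~ vAcc) (vPw <~ ENil)).

Definition residual_cmd : cmd :=
  pow_cmd ;;
  vAcc <~ vG ;; vC1 <~ EOp2 Defs.Sub EZero EOne ;; vM1 <~ EMon0 ;; vL2 <~ vPw ;;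
  axpy_cmd.

(** The leading term of the residual is divided by [q * lt(h) ^+ (q - 1)]: [vXq] holds the scalar
    [q], and [vSh] the exponent of the second factor, which stays the same as [h] grows
    downwards. *)
Definition refine_cmd : cmd :=
  vIt <~ vB ;;
  For vIt
    (residual_cmd ;;
     If vAcc
       (vS <~ vAcc ;; lead_cmd ;;
        vAcc <~ vH ;; vC1 <~ EOne ;; vM1 <~ EMon0 ;;
        vL2 <~ Pair (Pair (EOp2 Defs.Div vLc vXq) (EOp2 Defs.Sub vLm vSh)) ENil ;;
        axpy_cmd ;; vH <~ vAcc)
       skip).

(* Naturals cannot be divided, so that [e] is represented by the exponent vector
   [U_(0) *+ e].  The last candidate to be kept is the least [P] dividing [e] such
   that [e / P] is nonzero in the field. *)
Definition split_cmd : cmd :=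
  vMe <~ EMon0 ;; vI <~ vE ;;
  For vI (vMe <~ EOp2 Defs.Add vMe (EOp1 MUnit (ENat 0))) ;;
  vK <~ vE ;;
  For vK
    (vCand <~ EOp2 Defs.Add vK (ENat 1) ;;
     vQc <~ EOp2 MGet (EOp2 Defs.Div vMe vCand) (ENat 0) ;;
     vX <~ EZero ;; vCnt <~ vQc ;; For vCnt (vX <~ EOp2 Defs.Add vX EOne) ;;
     If (EOp2 MDvd vCand vMe)
       (If (EOp2 Defs.Eq vX EZero) skip
          (vP <~ vCand ;; vQ <~ vQc ;; vXq <~ vX))
       skip).

(** No extraction is spent on the leading coefficient, which becomes 1 after division, nor when [P]
    is 1. Comparing the sum of two truth values with 2 expresses their conjunction. *)
Definition frob_cmd : cmd :=
  vG <~ ENil ;; vOk <~ ENat 1 ;; vFl <~ vFL ;;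
  ForEach vFt vFl
    (vA <~ EOp2 Defs.Div (Fst vFt) vLC ;; vMm <~ Snd vFt ;;
     If (EOp2 Defs.Eq vMm vLM) (vR <~ EOne)
       (If (EOp2 Defs.Le vP (ENat 1)) (vR <~ vA) (Frob vR vE vA)) ;;
     If (EOp2 Defs.Eq (EOp2 Defs.Add (EOp1 IsScalar vR) (EOp2 MDvd vP vMm)) (ENat 2))
       (vG <~ Pair (Pair vR (EOp2 Defs.Div vMm vP)) vG)
       (vOk <~ ENat 0)).

(** The monomial order refines the degree, so the total degree is read off the leading exponent
    alone. *)
Definition degrees_cmd : cmd :=
  vTd <~ ENat 0 ;; vJ <~ vN ;;
  For vJ (vTd <~ EOp2 Defs.Add vTd (EOp2 MGet vLM vJ)) ;;
  vD <~ ENat 0 ;; vSz <~ ENat 0 ;; vDl <~ vFL ;;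
  ForEach vDt vDl
    (vSz <~ EOp2 Defs.Add vSz (ENat 1) ;; vJ <~ vN ;;
     For vJ
       (If (EOp2 Defs.Le vD (EOp2 MGet (Snd vDt) vJ))
          (vD <~ EOp2 MGet (Snd vDt) vJ) skip)).

(** Computes [s ^ (9 * (D * d))] by repeated addition, as naturals cannot be multiplied; the factor
    9 exceeds the 8 of the lattice point count. *)
Definition bound_cmd : cmd :=
  vBk <~ ENat 0 ;; vJ <~ vTd ;;
  For vJ (vBk <~ iter 9 (EOp2 Defs.Add (Var vD)) vBk) ;;
  vB <~ ENat 1 ;; vJ <~ vBk ;;
  For vJ
    (vB2 <~ ENat 0 ;; vC3 <~ vSz ;; For vC3 (vB2 <~ EOp2 Defs.Add vB2 vB) ;;
     vB <~ vB2).

Definition fail_cmd : cmd := 0%N <~ ENat 0.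

(** The search starts from the monic leading monomial of the root. The last residual certifies the
    result, which is then rescaled by the [e]-th root of the leading coefficient. *)
Definition solve_cmd : cmd :=
  degrees_cmd ;; bound_cmd ;;
  vM0 <~ EOp2 Defs.Div vLM vE ;;
  vSh <~ EOp2 Defs.Sub (EOp2 Defs.Div vLM vP) vM0 ;;
  vH <~ Pair (Pair EOne vM0) ENil ;;
  refine_cmd ;; residual_cmd ;;
  If vAcc fail_cmd
    (vAcc <~ ENil ;; vC1 <~ vRt ;; vM1 <~ EMon0 ;; vL2 <~ vH ;; axpy_cmd ;;
     0%N <~ vAcc).

(* The first test also ensures that [e] is at most the individual degree. *)
Definition root_cmd : cmd :=
  vN <~ Fst 0%N ;; vE <~ Fst (Snd 0%N) ;; vFL <~ Snd (Snd 0%N) ;;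
  vS <~ vFL ;; lead_cmd ;; vLC <~ vLc ;; vLM <~ vLm ;;
  If (EOp2 MDvd vE vLM)
    (Root vRt vE vLC ;;
     If (EOp1 IsScalar vRt)
       (split_cmd ;; frob_cmd ;; If vOk solve_cmd fail_cmd)
       fail_cmd)
    fail_cmd.

(** * Verification *)

Arguments upd {F n} st x v y /.
Arguments vbool : simpl never.
Arguments vbool {F n} b.
Arguments truth : simpl never.

Lemma truth_vbool (F : fieldType) n b : truth (@vbool F n b) = b.
Proof. by case: b. Qed.

Ltac wps := first [apply: wp_seq | apply: wp_assign]; cbv beta.

Lemma sum_const_seq (T : Type) (s : seq T) k : (\sum_(t <- s) k = k * size s)%N.
Proof. by rewrite big_const_seq count_predT iter_addn_0. Qed.

Section RootAlgorithm.
Variables (F : fieldType) (n : nat) (O : scalar_roots F) (R : nat -> nat).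
Implicit Types (st : store F n) (L : seq (F * 'X_{1..n})) (p : {mpoly F[n]}).
Local Notation wp := (wp O R).

Definition enc (t : F * 'X_{1..n}) : value F n := VCons (VScalar t.1) (VMonom t.2).

(** * Leading terms and sparse arithmetic *)

Lemma lead_fold L p : represents L p ->
  foldl (fun s t : F * 'X_{1..n} => if (s.2 <= t.2)%O then t else s) (0, 0%MM) L =
  (mleadc p, mlead p).
Proof.
move=> rL; set step := fun _ _ => _.
have foldP L' s : let r := foldl step s L' in
    (r = s \/ r \in L') /\ (s.2 <= r.2)%O /\ {in L', forall t, (t.2 <= r.2)%O}.
  elim: L' s => [|t L' IH] s /=; first by split; [left|].
  have [r1 [r2 r3]] := IH (step s t); set r := foldl _ _ _ in r1 r2 r3 *.
  have [s1 s2] : (s.2 <= (step s t).2)%O /\ (t.2 <= (step s t).2)%O.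
    by rewrite /step; case: (leP s.2 t.2) => //; split => //; apply: ltW.
  split; last split.
  - rewrite inE; case: r1 => [->|->]; last by right; rewrite orbT.
    by rewrite /step; case: ifP => _; [right; rewrite eqxx|left].
  - exact: le_trans r2.
  - move=> u; rewrite inE => /orP[/eqP ->|/r3 //]; exact: le_trans r2.
case: L rL => [|t L] rL.
  by case: rL => _ _ <-; rewrite /den big_nil mlead0 mcoeff0.
have E : step (0, 0%MM) t = t by rewrite /step le0x.
rewrite /= -/step E; have [r1 [r2 r3]] := foldP L t.
set r := foldl _ _ _ in r1 r2 r3 *.
have rtL : r \in t :: L by rewrite inE; case: r1 => [->|->]; rewrite ?eqxx ?orbT.
have er : mlead p = r.2.
  apply: mlead_eq; last first.
    by rewrite -mcoeff_msupp (represents_msupp rL); apply: map_f.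
  case: (eqVneq p 0) => [->|/mlead_supp]; first by rewrite mlead0 le0x.
  rewrite (represents_msupp rL) => /mapP[u uL ->].
  by move: uL; rewrite inE => /orP[/eqP ->|/r3].
by rewrite er (represents_coeff rL rtL) -surjective_pairing.
Qed.

Lemma wp_lead st L p : st vS = encode_terms L -> represents L p ->
  wp lead_cmd st (fun st' t =>
    [/\ st' vLc = VScalar (mleadc p), st' vLm = VMonom (mlead p) &
        (t <= 30 * size L + 10)%N]).
Proof.
move=> eL rL; rewrite /lead_cmd.
do 2!(wps; wps; rewrite /=).
pose step := fun s t : F * 'X_{1..n} => if (s.2 <= t.2)%O then t else s.
apply: (wp_conseq (wp_foreach (enc := enc) (ts := L) (tb := fun=> 20%N)
  (J := fun ts st => exists s, [/\ st vLc = VScalar s.1, st vLm = VMonom s.2 &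
     foldl step s ts = foldl step (0, 0%MM) L]) _ _ _ _ _)) => //.
- by exists (0, 0%MM).
- move=> t ts st1 _ [s [e5 e6 es]].
  apply: wp_if; rewrite /= ?e5 ?e6 /= truth_vbool => le_st.
    do 3!(wps; rewrite /=).
    by split=> //; exists t; split=> //; rewrite -es /= /step le_st.
  wps; rewrite /=; split=> //; exists s; split=> //.
  by rewrite -es /= /step (negbTE le_st).
move=> st' t _ /= [[s [-> -> es]] _ le_t].
rewrite (lead_fold rL : foldl step _ _ = _) in es.
by rewrite es; split=> //; rewrite sum_const_seq in le_t; lia.
Qed.

Lemma wp_add_term st L t : st vAcc = encode_terms L ->
  st vC = VScalar t.1 -> st vM = VMonom t.2 ->
  wp add_term_cmd st (fun st' k =>
    st' vAcc = encode_terms (add_term L t) /\ (k <= 30 * size L + 30)%N).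
Proof.
move=> eL ec em; rewrite /add_term_cmd.
do 5!(wps; rewrite /=).
apply: (wp_conseq (wp_foreach (enc := enc) (ts := L) (tb := fun=> 20%N)
  (J := fun ts st => exists L0, [/\ L = L0 ++ ts,
     st vC = VScalar (\sum_(u <- L0 | u.2 == t.2) u.1 + t.1) &
     st vNew = encode_terms (rev [seq u <- L0 | u.2 != t.2])]) _ _ _ _ _)) => //.
- by exists [::]; rewrite /= ec big_nil add0r.
- move=> u ts st1 ast1 [L0 [eL0 eC eN]].
  have eM : st1 vM = VMonom t.2 by rewrite ast1 //= em.
  apply: wp_if; rewrite /= ?eM /= truth_vbool => eut.
    wps; rewrite /=; split=> //; exists (rcons L0 u); rewrite cat_rcons; split=> //.
      by rewrite eC /= -cats1 big_cat big_cons big_nil /= eut addr0 addrA [u.1 + _]addrC.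
    by rewrite filter_rcons eut.
  wps; rewrite /=; split=> //; exists (rcons L0 u); rewrite cat_rcons; split=> //.
    by rewrite -cats1 big_cat big_cons big_nil /= (negbTE eut) addr0.
  by rewrite filter_rcons eut rev_rcons /= eN.
move=> st1 k ak [[L0 [eL0 eC eN]] _ le_k].
rewrite cats0 in eL0; rewrite -eL0 in eC eN.
have eM : st1 vM = VMonom t.2 by rewrite ak //= em.
rewrite sum_const_seq in le_k.
apply: wp_if; rewrite /= eC /= truth_vbool => c0; wps; rewrite /= /add_term.
  by rewrite c0 eN; split=> //; lia.
by rewrite (negbTE c0) eN eC eM /=; split=> //; lia.
Qed.

Lemma wp_axpy st L p L2 c m : st vAcc = encode_terms L -> represents L p ->
  st vC1 = VScalar c -> st vM1 = VMonom m -> st vL2 = encode_terms L2 ->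
  wp axpy_cmd st (fun st' k => exists L', [/\ st' vAcc = encode_terms L',
    represents L' (p + c *: 'X_[m] * den L2), (size L' <= size L + size L2)%N &
    (k <= size L2 * (30 * (size L + size L2) + 60) + 2)%N]).
Proof.
move=> eL rL ec em eL2.
apply: (wp_conseq (wp_foreach (enc := enc) (ts := L2)
  (tb := fun=> (30 * (size L + size L2) + 50)%N)
  (J := fun ts st => exists L' T, [/\ L2 = T ++ ts, st vAcc = encode_terms L',
    represents L' (p + c *: 'X_[m] * den T) &
    (size L' <= size L + size T)%N]) _ _ _ _ _)) => //.
- by exists L, [::]; split; rewrite /den ?big_nil ?mulr0 ?addr0 ?addn0.
- move=> t ts st1 ast1 [L' [T [eT eL' rL' sL']]].
  have e1 : st1 vC1 = VScalar c by rewrite ast1.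
  have e2 : st1 vM1 = VMonom m by rewrite ast1.
  do 4!(wps; rewrite /=); rewrite e1 e2 /=.
  apply: wp_conseq (wp_add_term (L := L') (t := (c * t.1, (m + t.2)%MM)) _ _ _) _ => //.
  move=> st2 k _ [eL'' le_k]; split.
    by have := congr1 size eT; rewrite size_cat /=; lia.
  exists (add_term L' (c * t.1, (m + t.2)%MM)), (rcons T t).
  rewrite cat_rcons size_rcons; split=> //.
    have -> : p + c *: 'X_[m] * den (rcons T t) =
        p + c *: 'X_[m] * den T + (c * t.1) *: 'X_[m + t.2].
      rewrite -cats1 /den big_cat big_cons big_nil /= addr0 mulrDr addrA; congr (_ + _).
      by rewrite mpolyXD -scalerAl -scalerAr scalerA.
    exact: add_term_represents.
  by apply: leq_trans (size_add_term _ _) _; rewrite addnS ltnS.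
move=> st' k _ [[L' [T [eT eL' rL' sL']]] _ le_k].
rewrite cats0 in eT; subst T; exists L'; split=> //.
by rewrite sum_const_seq in le_k; nia.
Qed.

(** The accumulator never exceeds [W * W] terms, so each of the at most [W] rows costs a multiple of
    [W ^ 3]. *)
Lemma wp_mul st A H W : st vPw = encode_terms A -> st vH = encode_terms H ->
  (0 < W)%N -> (size A <= W)%N -> (size H <= W)%N ->
  wp mul_cmd st (fun st' k => exists L, [/\ st' vAcc = encode_terms L,
    represents L (den A * den H), (size L <= W * W)%N & (k <= 160 * W ^ 4)%N]).
Proof.
move=> eA eH W0 sA sH; do 4!(wps; rewrite /=).
apply: (wp_conseq (wp_foreach (enc := enc) (ts := A) (tb := fun=> (140 * W ^ 3)%N)
  (J := fun ts st => exists L T, [/\ A = T ++ ts, st vAcc = encode_terms L,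
    represents L (den T * den H) &
    (size L <= size T * size H)%N]) _ _ _ _ _)) => //.
- by exists [::], [::]; split; rewrite // /den big_nil mul0r; apply/represents_nil.
- move=> t ts st1 ast1 [L [T [eT eL rL sL]]].
  have e1 : st1 vH = encode_terms H by rewrite ast1.
  do 6!(wps; rewrite /=); rewrite e1.
  apply: wp_conseq (wp_axpy (L := L) (L2 := H) (c := t.1) (m := t.2) _ rL _ _ _) _ => //.
  move=> st2 k _ [L' [eL' rL' sL' le_k]]; split.
    have sT : (size T < W)%N by apply: leq_trans sA; rewrite eT size_cat /=; lia.
    have sLW : (size L + size H <= W * W)%N by nia.
    have : (size H * (30 * (size L + size H) + 60) <= W * (30 * (W * W) + 60))%N.
      by apply: leq_mul => //; rewrite leq_add2r leq_mul2l sLW.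
    by rewrite !expnS expn0; nia.
  exists L', (rcons T t); rewrite cat_rcons size_rcons; split=> //; last first.
    by apply: leq_trans sL' _; rewrite mulSn; lia.
  have -> : den (rcons T t) = den T + t.1 *: 'X_[t.2].
    by rewrite -cats1 /den big_cat big_cons big_nil /= addr0.
  by rewrite mulrDl.
move=> st' k _ [[L [T [eT eL rL sL]]] _ le_k].
rewrite cats0 in eT; subst T; exists L; split=> //.
  by apply: leq_trans sL _; apply: leq_mul.
rewrite sum_const_seq in le_k.
have le1 : (140 * W ^ 3 * size A <= 140 * W ^ 3 * W)%N by rewrite leq_mul2l sA orbT.
have le2 : (W <= W * W ^ 3)%N by rewrite leq_pmulr // expn_gt0 W0.
by rewrite (expnS _ 3); move: (W ^ 3)%N le1 le2 le_k => W3; lia.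
Qed.

(** The unconditional alternative gives soundness of the final test; the conditional equality gives
    completeness when a root exists. Once the cut-off has produced 0, all later products are 0. *)
Lemma wp_pow st H h q B W : st vH = encode_terms H -> represents H h ->
  st vQ = VNat q -> st vB = VNat B ->
  (0 < W)%N -> (size H <= W)%N -> (B <= W)%N -> (q <= W)%N ->
  wp pow_cmd st (fun st' k => exists A r, [/\ st' vPw = encode_terms A,
    represents A r, r = 0 \/ r = h ^+ q,
    (forall i, (i <= q)%N -> (sparsity (h ^+ i) <= B)%N) -> r = h ^+ q &
    (size A <= W)%N /\ (k <= 300 * W ^ 5)%N]).
Proof.
move=> eH rH eQ eB W0 sH BW qW; do 4!(wps; rewrite /=); rewrite eQ.
apply: (wp_conseq (wp_for (k := q) (tb := (250 * W ^ 4)%N)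
  (J := fun j st => exists A r, [/\ st vPw = encode_terms A, represents A r,
    r = 0 \/ r = h ^+ (q - j),
    (forall i, (i <= q)%N -> (sparsity (h ^+ i) <= B)%N) -> r = h ^+ (q - j) &
    (size A <= W)%N]) _ _ _ _)) => //.
- exists [:: (1, 0%MM)], 1; rewrite subnn expr0; split=> //; last by right.
  by split=> //=; rewrite ?oner_eq0 // /den big_cons big_nil addr0 /= mpolyX0 scale1r.
- move=> j st1 jq ast1 [A [r [eA rA hr hr' sA]]].
  have eH1 : st1 vH = encode_terms H by rewrite ast1.
  have eB1 : st1 vB = VNat B by rewrite ast1.
  apply: wp_seq; apply: wp_conseq (wp_mul (A := A) (H := H) _ _ W0 sA sH) _ => //.
  move=> st2 k2 a2 [L [eL rL sL le_k2]].
  do 4!(wps; rewrite /=); rewrite eL; wps.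
  apply: (wp_conseq (wp_foreach (enc := enc) (ts := L) (tb := fun=> 20%N)
    (J := fun ts st => exists2 T, L = T ++ ts & st vLen = VNat (size T)) _ _ _ _ _)) => //.
  + by exists [::].
  + move=> t ts st3 ast3 [T eT e3]; wps; rewrite /= e3 /=; split=> //.
    by exists (rcons T t); rewrite ?cat_rcons // size_rcons addn1.
  move=> st3 k3 a3 [[T eT e3] _ le_k3].
  rewrite cats0 in eT; subst T.
  have eB3 : st3 vB = VNat B by rewrite a3 //= a2.
  have eL3 : st3 vAcc = encode_terms L by rewrite a3 //= eL.
  have W4 : (1 <= W ^ 4)%N by rewrite expn_gt0 W0.
  have W24 : (W * W <= W ^ 4)%N by rewrite mulnn leq_pexp2l.
  rewrite sum_const_seq in le_k3.
  case: rA hr' => _ _ dA hr'; case: rH => _ _ dH; rewrite dA dH in rL.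
  have qj : (q - j = (q - j.+1).+1)%N by lia.
  apply: wp_if; rewrite /= e3 eB3 /= truth_vbool => leLB; wps; rewrite /= ?eL3.
    split; first by lia.
    exists L, (r * h); rewrite qj exprSr; split=> //.
    - by case: hr => ->; [left; rewrite mul0r|right].
    - by move=> /hr' ->.
    - exact: leq_trans leLB _.
  split; first by lia.
  exists [::], 0; split=> //; [exact/represents_nil|by left|].
  (* When all powers are sparse, the product is a power of [h] and cannot exceed the cut-off. *)
  move=> sp; case/negP: leLB.
  have := sp _ (leq_subr j q); rewrite {1}qj exprSr -(hr' sp).
  by rewrite -(represents_size rL).
move=> st' k a' [[A [r [eA rA hr hr' sA]]] _ le_k].
rewrite subn0 in hr hr'; exists A, r; split=> //; split=> //.
have le1 : (q * (250 * W ^ 4 + 6) <= W * (250 * W ^ 4 + 6))%N.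
  by rewrite leq_mul2r qW orbT.
have le2 : (W <= W * W ^ 4)%N by rewrite leq_pmulr // expn_gt0 W0.
by rewrite (expnS _ 4); move: (W ^ 4)%N le1 le2 le_k => W4; lia.
Qed.

Lemma wp_residual st H h G g q B W :
  st vH = encode_terms H -> represents H h ->
  st vG = encode_terms G -> represents G g ->
  st vQ = VNat q -> st vB = VNat B ->
  (0 < W)%N -> (size H <= W)%N -> (size G <= W)%N -> (B <= W)%N -> (q <= W)%N ->
  wp residual_cmd st (fun st' k => exists A r, [/\ st' vAcc = encode_terms A,
    represents A (g - r), r = 0 \/ r = h ^+ q,
    (forall i, (i <= q)%N -> (sparsity (h ^+ i) <= B)%N) -> r = h ^+ q &
    (size A <= 2 * W)%N /\ (k <= 450 * W ^ 5)%N]).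
Proof.
move=> eH rH eG rG eQ eB W0 sH sG BW qW; apply: wp_seq.
apply: wp_conseq (wp_pow (h := h) eH rH eQ eB W0 sH BW qW) _ => //.
move=> st1 k1 a1 [A [r [eA rA hr hr' [sA le_k1]]]].
have eG1 : st1 vG = encode_terms G by rewrite a1.
do 8!(wps; rewrite /=); rewrite eG1 eA.
apply: wp_conseq (wp_axpy (L := G) (L2 := A) (c := 0 - 1) (m := 0%MM) _ rG _ _ _) _ => //.
move=> st2 k2 _ [L [eL rL sL le_k2]]; exists L, r; split=> //.
  by case: rA rL => _ _ ->; rewrite sub0r mpolyX0 scaleN1r mulN1r.
split; first by lia.
have le1 : (size A * (30 * (size G + size A) + 60) <= W * (60 * W + 60))%N.
  by apply: leq_mul => //; lia.
have le2 : (W * W <= W ^ 5)%N by rewrite mulnn leq_pexp2l.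
have le3 : (W <= W * W)%N by rewrite leq_pmulr.
by move: (W ^ 5)%N le2 le_k1 => W5; lia.
Qed.

(** * Recovery of the monic root, term by term *)

Definition bounded_powers (g : {mpoly F[n]}) q B := forall (h : {mpoly F[n]}) i,
  {subset msupp h <= msupp g} -> (i <= q)%N -> (sparsity (h ^+ i) <= B)%N.

(** By [lead_pow_diff], the computed [t] is the leading term of the unknown [r]; moving it into [h]
    removes one term from [r]. *)
Lemma refine_step (g h r : {mpoly F[n]}) q
    (c := mleadc (g ^+ q - h ^+ q) / q%:R)
    (m := (mlead (g ^+ q - h ^+ q) - mlead h *+ q.-1)%MM)
    (t := c *: 'X_[m]) :
  (0 < q)%N -> q%:R != 0 :> F -> g = h + r -> mleadc h = 1 -> dominates h r ->
  g ^+ q != h ^+ q ->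
  [/\ g = (h + t) + (r - t), mlead (h + t) = mlead h, mleadc (h + t) = 1,
      dominates (h + t) (r - t) & sparsity r = (sparsity (r - t)).+1].
Proof.
move=> q0 qF0 eg h1 dom ne.
have r0 : r != 0 by apply: contraNneq ne => r0; rewrite eg r0 addr0.
have h0 : h != 0.
  by apply/eqP => h0; move: h1; rewrite h0 mleadc0 => /esym/eqP; rewrite oner_eq0.
have [em ec] := lead_pow_diff h1 r0 dom q0 qF0; rewrite -eg in em ec.
have ->: t = mleadc r *: 'X_[mlead r].
  by rewrite /t /c /m ec em addmC addmK [q%:R * _]mulrC mulfK.
have lt_rh : (mlead r < mlead h)%O by apply: dom; apply: mlead_supp.
have c0 : mleadc r != 0 by rewrite mleadc_eq0.
have lt : mlead (mleadc r *: 'X_[mlead r]) = mlead r by rewrite mleadZ // mleadXm.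
have lh : mlead (h + mleadc r *: 'X_[mlead r]) = mlead h by rewrite mleadDl ?lt.
split=> //.
- by rewrite eg addrACA subrr addr0.
- by rewrite lh mcoeffD h1 [X in _ + X]mcoeff_gt_mlead ?addr0 ?lt.
- exact: dominates_step.
- rewrite sparsity_sub_lead // prednK // /sparsity lt0n size_eq0.
  by rewrite msupp_eq0.
Qed.

(** The size of [H] is controlled unconditionally, for the running time. The algebraic invariant is
    relative to a hypothetical root [g]: with [j] iterations left, at most [j] terms of [g] are
    missing. *)
Lemma wp_refine st G f q B W (m0 : 'X_{1..n}) :
  st vH = encode_terms [:: (1, m0)] -> st vG = encode_terms G -> represents G f ->
  st vQ = VNat q -> st vB = VNat B -> st vXq = VScalar q%:R ->
  st vSh = VMonom (m0 *+ q.-1)%MM ->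
  (0 < q)%N -> q%:R != 0 :> F ->
  (0 < W)%N -> (size G <= W)%N -> (B < W)%N -> (q <= W)%N ->
  wp refine_cmd st (fun st' k => exists H h, [/\ st' vH = encode_terms H,
    represents H h, (size H <= W)%N, (k <= 800 * W ^ 6)%N &
    forall g, mleadc g = 1 -> mlead g = m0 -> g ^+ q = f ->
      bounded_powers g q B -> h = g]).
Proof.
move=> eH eG rG eQ eB eX eS q0 qF0 W0 sG BW qW; do 2!(wps; rewrite /=).
apply: (wp_conseq (wp_for (k := B) (tb := (700 * W ^ 5)%N)
  (J := fun j st => exists H h, [/\ st vH = encode_terms H, represents H h,
    (size H <= (B - j).+1)%N &
    forall g, mleadc g = 1 -> mlead g = m0 -> g ^+ q = f -> bounded_powers g q B ->
    exists r, [/\ g = h + r, mlead h = m0, mleadc h = 1, dominates h r &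
                  (sparsity r <= j)%N]]) _ _ _ _)) => //.
- exists [:: (1, m0)], 'X_[m0]; split=> //.
    by split; rewrite //= ?oner_eq0 // /den big_seq1 scale1r.
  move=> g g1 lg eg bg; exists (g - 'X_[m0]).
  have := @dominates_lead _ _ g; rewrite g1 lg scale1r => dom.
  have g0 : g != 0.
    by apply/eqP => g0; move: g1; rewrite g0 mleadc0 => /esym/eqP; rewrite oner_eq0.
  split; rewrite ?mleadXm ?mcoeffX ?eqxx //; first by rewrite addrC subrK.
  have := sparsity_sub_lead g0; rewrite g1 lg scale1r => ->.
  (* The bound at the first power limits the number of terms of [g] itself. *)
  have := bg g 1%N (fun _ => id) q0; rewrite expr1.
  by apply: leq_trans; apply: leq_pred.
- move=> j st1 jB ast1 [H [h [eH1 rH sH hg]]].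
  have eG1 : st1 vG = encode_terms G by rewrite ast1.
  have eQ1 : st1 vQ = VNat q by rewrite ast1.
  have eB1 : st1 vB = VNat B by rewrite ast1.
  have sHW : (size H <= W)%N by apply: leq_trans sH _; lia.
  apply: wp_seq.
  apply: wp_conseq (wp_residual (H := H) (h := h) (G := G) (g := f) (q := q)
    (B := B) (W := W) _ rH _ rG _ _ W0 sHW sG (ltnW BW) qW) _ => //.
  move=> st2 k2 a2 [A [r0 [eA rA hr0 hr0' [sA le_k2]]]].
  have W5 : (W <= W ^ 5)%N by rewrite -{1}[W]expn1 leq_pexp2l.
  have pow_h g : mleadc g = 1 -> mlead g = m0 -> g ^+ q = f -> bounded_powers g q B ->
      r0 = h ^+ q.
    move=> g1 lg eg bg; have [r [er _ _ dom _]] := hg g g1 lg eg bg.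
    apply: hr0' => i iq; apply: bg => //; rewrite er.
    exact: dominates_sub.
  apply: wp_if; rewrite /= eA => tA.
    have eX2 : st2 vXq = VScalar q%:R by rewrite a2 //= ast1.
    have eS2 : st2 vSh = VMonom (m0 *+ q.-1)%MM by rewrite a2 //= ast1.
    have eH2 : st2 vH = encode_terms H by rewrite a2.
    do 2!(wps; rewrite /=); rewrite eA; wps.
    apply: wp_conseq (wp_lead (L := A) _ rA) _ => //.
    move=> st3 k3 a3 [eLc eLm le_k3].
    have eX3 : st3 vXq = VScalar q%:R by rewrite a3.
    have eS3 : st3 vSh = VMonom (m0 *+ q.-1)%MM by rewrite a3.
    have eH3 : st3 vH = encode_terms H by rewrite a3.
    do 9!(wps; rewrite /=); rewrite eLc eLm eX3 eS3 eH3 /=.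
    set c := _ / _; set m := (_ - _)%MM.
    apply: wp_conseq (wp_axpy (L := H) (L2 := [:: (c, m)]) (c := 1) (m := 0%MM)
      _ rH _ _ _) _ => //.
    move=> st4 k4 _ [H' [eH' rH' sH' le_k4]]; wps; rewrite /= eH'; split.
      by rewrite /= in le_k4; lia.
    exists H', (h + c *: 'X_[m]); split=> //.
    - by move: rH'; rewrite mpolyX0 scale1r mul1r /den big_seq1.
    - by apply: leq_trans sH' _; rewrite /= addn1; lia.
    move=> g g1 lg eg bg; have er0 := pow_h g g1 lg eg bg.
    have [r [er lh h1 dom sr]] := hg g g1 lg eg bg.
    have ne : g ^+ q != h ^+ q.
      apply: contraTneq tA => egh; move: rA.
      by rewrite er0 -eg egh subrr => /represents_nil ->.
    have [e1 e2 e3 e4 e5] := refine_step q0 qF0 er h1 dom ne.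
    move: e1 e2 e3 e4 e5; rewrite lh eg -er0 -/c -/m => e1 e2 e3 e4 e5.
    by exists (r - c *: 'X_[m]); split=> //; rewrite -ltnS -e5.
  have A0 : A = [::] by case: (A) tA.
  wps; rewrite /=; split; first by lia.
  exists H, h; split=> //; first by rewrite a2.
    by apply: leq_trans sH _; lia.
  move=> g g1 lg eg bg; have er0 := pow_h g g1 lg eg bg.
  have [r [er lh h1 dom sr]] := hg g g1 lg eg bg.
  have egh : g ^+ q = h ^+ q.
    case: rA => _ _; rewrite A0 /den big_nil eg -er0 => /esym/eqP.
    by rewrite subr_eq0 => /eqP.
  (* A nonzero remainder would give the vanishing difference of powers a nonzero leading
     coefficient. *)
  have r00 : r = 0.
    apply/eqP/negPn/negP => rn0.
    have [_ ] := lead_pow_diff h1 rn0 dom q0 qF0.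
    rewrite -er egh subrr mleadc0 => /esym/eqP.
    by rewrite mulf_eq0 (negbTE qF0) mleadc_eq0 (negbTE rn0).
  by exists r; split=> //; rewrite r00 /sparsity msupp0.
move=> st' k _ [[H [h [eH' rH sH hg]]] _ le_k]; exists H, h; split=> //.
- by apply: leq_trans sH _; lia.
- have le1 : (B * (700 * W ^ 5 + 6) <= W * (700 * W ^ 5 + 6))%N.
    by rewrite leq_mul2r ltnW ?orbT.
  have le2 : (W <= W * W ^ 5)%N by rewrite leq_pmulr // expn_gt0 W0.
  by rewrite (expnS _ 5); move: (W ^ 5)%N le1 le2 le_k => W5; lia.
- move=> g g1 lg eg bg; have [r [-> _ _ _]] := hg g g1 lg eg bg.
  by rewrite leqn0 /sparsity size_eq0 msupp_eq0 => /eqP ->; rewrite addr0.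
Qed.

(** * Splitting the exponent along the characteristic *)

Lemma insub_ord k (kn : (k < n)%N) : insub k = Some (Ordinal kn).
Proof. by rewrite insubT. Qed.

Lemma wp_split st e : st vE = VNat e -> (0 < e)%N -> (0 < n)%N ->
  wp split_cmd st (fun st' k => let P := (e`_[pchar F])%N in
    [/\ st' vP = VNat P, st' vQ = VNat (e %/ P), st' vXq = VScalar (e %/ P)%:R &
        (k <= e * (20 * e + 150) + 20)%N]).
Proof.
move=> eE e0 n0; pose i0 := Ordinal n0.
do 4!(wps; rewrite /=); rewrite eE; wps.
apply: (wp_conseq (wp_for (k := e) (tb := 10%N)
  (J := fun j st => st vMe = VMonom (U_(i0) *+ (e - j))%MM) _ _ _ _)) => //.
- by rewrite /= subnn.
- move=> j st1 je _ e1; wps; rewrite /= e1 (insub_ord n0) /=; split=> //.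
  by rewrite (_ : (e - j = (e - j.+1).+1)%N) ?mulmS 1?addmC //; lia.
move=> st1 k1 a1 [eMe _ le_k1]; rewrite subn0 in eMe.
have eE1 : st1 vE = VNat e by rewrite a1.
have divMe k : (mnm_div (U_(i0) *+ e) k) i0 = (e %/ k)%N.
  by rewrite mnmE mulmnE mnmE eqxx mul1n.
have dvdMe k : [forall i, (k %| (U_(i0) *+ e)%MM i)%N] = (k %| e)%N.
  apply/forallP/idP => [/(_ i0)|ke i]; rewrite mulmnE mnmE ?eqxx ?mul1n //.
  exact: dvdn_mull.
do 2!(wps; rewrite /=); rewrite eE1.
pose valid j := ((0 < j) && (j %| e))%N && ((e %/ j)%:R != 0 :> F).
have valid_e : valid e by rewrite /valid e0 dvdnn divnn e0 oner_eq0.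
(* The registers hold the least valid candidate above [j]. The guard [j < e] covers the start, when
   nothing is stored; the first candidate tried is [e], which is always valid. *)
apply: (wp_conseq (wp_for (k := e) (tb := (20 * e + 100)%N)
  (J := fun j st => (j < e)%N -> exists P, [/\ st vP = VNat P,
    st vQ = VNat (e %/ P), st vXq = VScalar (e %/ P)%:R, valid P &
    forall i, valid i -> (j < i)%N -> (P <= i)%N]) _ _ _ _)) => //.
- by rewrite ltnn.
- move=> j st2 je a2 Jj.
  have eMe2 : st2 vMe = VMonom (U_(i0) *+ e)%MM by rewrite a2.
  do 8!(wps; rewrite /=); rewrite eMe2 /= (insub_ord n0) divMe; wps.
  apply: (wp_conseq (wp_for (k := (e %/ (j + 1))%N) (tb := 10%N)
    (J := fun i st => st vX = VScalar (e %/ (j + 1) - i)%:R) _ _ _ _)) => //.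
  + by rewrite /= subnn.
  + move=> i st3 ij _ e3; wps; rewrite /= e3 /=; split=> //.
    by rewrite natr1; congr (VScalar _%:R); lia.
  move=> st3 k3 a3 [eX _ le_k3]; rewrite subn0 in eX.
  have eMe3 : st3 vMe = VMonom (U_(i0) *+ e)%MM by rewrite a3.
  have eC3 : st3 vCand = VNat (j + 1) by rewrite a3.
  have eQ3 : st3 vQc = VNat (e %/ (j + 1)) by rewrite a3.
  have le_q : (e %/ (j + 1) <= e)%N by apply: leq_div.
  have old st4 : (st4 vP = st2 vP) -> st4 vQ = st2 vQ -> st4 vXq = st2 vXq ->
      ~~ valid j.+1 -> (j < e)%N -> exists P, [/\ st4 vP = VNat P,
    st4 vQ = VNat (e %/ P), st4 vXq = VScalar (e %/ P)%:R, valid P &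
    forall i, valid i -> (j < i)%N -> (P <= i)%N].
    move=> -> -> -> nv _; have je' : (j.+1 < e)%N.
      by rewrite ltn_neqAle je andbT; apply: contraNneq nv => ->.
    have [P [h1 h2 h3 vP hP]] := Jj je'; exists P; split=> // i vi ji.
    apply: hP => //; rewrite ltn_neqAle ji andbT.
    by apply: contraNneq nv => ->.
  apply: wp_if; rewrite /= eC3 eMe3 /= truth_vbool dvdMe => dj; last first.
    wps; rewrite /=; split; first by lia.
    apply: old; rewrite /= ?a3 //.
    by rewrite /valid -(addn1 j) (negbTE dj) andbF.
  apply: wp_if; rewrite /= eX /= truth_vbool => x0.
    wps; rewrite /=; split; first by lia.
    apply: old; rewrite /= ?a3 //.
    by rewrite /valid -(addn1 j) x0 andbF.
  do 5!(wps; rewrite /=); rewrite eC3 eQ3 eX; split; first by lia.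
  move=> _; exists (j + 1)%N; split=> //.
    by rewrite /valid addn1 -(addn1 j) dj x0 addn1.
  by move=> i _; rewrite addn1.
move=> st2 k2 _ [/(_ e0) [P [-> -> -> vP hP]] _ le_k2].
have -> : (e`_[pchar F])%N = P.
  move: vP; rewrite /valid => /andP[/andP[P0 Pe] qP]; apply/esym/pchar_part => //.
  by move=> j j0 je qj; apply: hP => //; rewrite /valid j0 je qj.
by split=> //; lia.
Qed.

(** * Frobenius roots of the coefficients *)

Section FrobLoop.
Variables (ts : seq (F * 'X_{1..n})) (f : {mpoly F[n]}) (e : nat).
Hypotheses (rts : represents ts f) (f0 : f != 0) (e0 : (0 < e)%N).
Let P := (e`_[pchar F])%N.
Let c := mleadc f.

Let frob_coef (t : F * 'X_{1..n}) : option F :=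
  if t.2 == mlead f then Some 1
  else if (P <= 1)%N then Some (t.1 / c) else scalar_frob O e (t.1 / c).

Let good t := (frob_coef t : bool) && [forall i, (P %| t.2 i)%N].

(** The default 0 occurs only for terms that are not [good], which are filtered out. *)
Let frob_term t := (odflt 0 (frob_coef t), mnm_div t.2 P).

Let c0 : c != 0. Proof. by rewrite mleadc_eq0. Qed.

Let P0 : (0 < P)%N. Proof. exact: part_gt0. Qed.

Lemma frob_coefP t : t \in ts -> root_spec P (t.1 / c) (frob_coef t).
Proof.
move=> tts; rewrite /frob_coef; case: eqP => [et|_].
  by rewrite /= expr1n -(represents_coeff rts tts) et divff.
case: leqP => P1; last exact: scalar_frob_part.
by have -> : P = 1%N; [lia | rewrite /= expr1].
Qed.

Lemma frob_good : all good ts -> exists g, [/\ g ^+ P = c^-1 *: f,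
  represents (rev (map frob_term (filter good ts))) g & sparsity g = size ts].
Proof.
move=> /[dup] /all_filterP -> /allP gd.
have [|rG eg] := @represents_frob_root n F P ts (map frob_term ts) f c
  (fun t => odflt 0 (frob_coef t)) (part_pnat _ _) c0 rts _ erefl.
  move=> t tts; have := frob_coefP tts; have := gd _ tts; rewrite /good.
  by case: (frob_coef t) => //= b /forallP.
exists (den (map frob_term ts)); split=> //.
  by apply: represents_perm rG; rewrite perm_sym perm_rev.
by rewrite -(represents_size rG) size_map.
Qed.

Lemma root_frob_good g : g ^+ P = c^-1 *: f -> all good ts.
Proof.
move=> eg; apply/allP => t tts.
have [dP [b eb]] := frob_root_terms (part_pnat _ _) c0 rts eg tts.
rewrite /good; apply/andP; split; last exact/forallP.
by have := frob_coefP tts; case: (frob_coef t) => //= /(_ b).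
Qed.

(** The leading exponent occurs exactly once, which saves one Frobenius extraction and leaves room
    for the single [e]-th root. *)
Lemma count_not_lead : count (fun t => t.2 != mlead f) ts = (size ts).-1.
Proof.
have [uts _ _] := rts.
have := count_predC (fun t => t.2 == mlead f) ts.
have -> : count (fun t => t.2 == mlead f) ts = count_mem (mlead f) (unzip2 ts).
  by rewrite count_map.
rewrite count_uniq_mem // -(represents_msupp rts) mlead_supp //= add1n => <-.
by [].
Qed.

Lemma wp_frob_cmd st : st vE = VNat e -> st vP = VNat P ->
  st vFL = encode_terms ts -> st vLC = VScalar c -> st vLM = VMonom (mlead f) ->
  wp frob_cmd st (fun st' k => exists ok : bool, [/\ st' vOk = vbool ok,
    ok -> exists G g, [/\ st' vG = encode_terms G, represents G g,
                         g ^+ P = c^-1 *: f & size G = size ts],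
    forall g, g ^+ P = c^-1 *: f -> ok &
    (k <= 80 * size ts + 20 + (size ts).-1 * R e)%N]).
Proof.
move=> eE eP eFL eC eM; do 6!(wps; rewrite /=); rewrite eFL.
apply: (wp_conseq (wp_foreach (enc := enc) (ts := ts)
  (tb := fun t => (60 + (t.2 != mlead f) * R e)%N)
  (J := fun ts' st => exists T, [/\ ts = T ++ ts',
     st vG = encode_terms (rev (map frob_term (filter good T))) &
     st vOk = vbool (all good T)]) _ _ _ _ _)) => //.
- by exists [::].
- move=> t ts' st1 a1 [T [eT eG eO]].
  have eE1 : st1 vE = VNat e by rewrite a1.
  have eP1 : st1 vP = VNat P by rewrite a1.
  have eC1 : st1 vLC = VScalar c by rewrite a1.
  have eM1 : st1 vLM = VMonom (mlead f) by rewrite a1.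
  do 4!(wps; rewrite /=); rewrite eC1 /=.
  apply: wp_seq.
  set st2 := upd _ _ _.
  have main : wp (If (EOp2 Defs.Eq vMm vLM) (vR <~ EOne)
       (If (EOp2 Defs.Le vP (ENat 1)) (vR <~ vA) (Frob vR vE vA))) st2
     (fun st3 k => st3 vR = voption n (frob_coef t) /\
        (k <= 20 + (t.2 != mlead f) * R e)%N).
    rewrite /frob_coef; apply: wp_if; rewrite /st2 /= eM1 /= truth_vbool => et.
      by wps; rewrite /= et.
    rewrite (negbTE et) /= mul1n; apply: wp_if; rewrite /= eP1 /= truth_vbool => P1.
      by wps; rewrite /= P1 /=; split=> //; lia.
    apply: (wp_frob (k := e) (a := t.1 / c)) => //=.
    by rewrite (negbTE P1); split=> //; lia.
  apply: wp_conseq main _ => st3 k3 a3 [eR le_k3].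
  have eP3 : st3 vP = VNat P by rewrite a3.
  have eMm3 : st3 vMm = VMonom t.2 by rewrite a3.
  have eG3 : st3 vG = st1 vG by rewrite a3.
  have eO3 : st3 vOk = st1 vOk by rewrite a3.
  have truthE : truth (eval st3 (EOp2 Defs.Eq (EOp2 Defs.Add (EOp1 IsScalar vR)
      (EOp2 MDvd vP vMm)) (ENat 2))) = good t.
    rewrite /= eP3 eMm3 eR /good; case: (frob_coef t) => [b|] //=.
      by case: [forall i, _].
    by case: [forall i, _].
  apply: wp_if; rewrite truthE => gt.
    wps; rewrite /= eP3 eMm3 eR eG3 eG eO3 eO /=; split; first by lia.
    exists (rcons T t); rewrite cat_rcons filter_rcons gt map_rcons rev_rcons.
    rewrite all_rcons gt; split=> //=.
    by move: gt; rewrite /good /frob_term; case: (frob_coef t).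
  wps; rewrite /= eG3 eG; split; first by lia.
  exists (rcons T t); rewrite cat_rcons filter_rcons (negbTE gt) all_rcons.
  by rewrite (negbTE gt).
move=> st' k _ [[T [eT eG eO]] _ le_k].
rewrite cats0 in eT; subst T; exists (all good ts); split=> //.
- move=> /frob_good [g [eg rG sG]].
  exists (rev (map frob_term (filter good ts))), g; split=> //.
  by rewrite (represents_size rG).
- by move=> g /root_frob_good.
- rewrite big_split /= sum_const_seq -big_distrl /= in le_k.
  have -> : (size ts).-1 = (\sum_(t <- ts) (t.2 != mlead f))%N.
    by rewrite -count_not_lead -sum1_count big_mkcond; apply: eq_bigr => t _; case: ifP.
  by lia.
Qed.

End FrobLoop.

(** * Degrees and the sparsity bound *)

Lemma mdeg_lead (f : {mpoly F[n]}) : f != 0 -> mdeg (mlead f) = tdeg f.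
Proof. by move=> /mlead_deg; rewrite /tdeg => <-. Qed.

Lemma wp_degrees st (ts : seq (F * 'X_{1..n})) (f : {mpoly F[n]}) :
  f != 0 -> represents ts f ->
  st vN = VNat n -> st vLM = VMonom (mlead f) -> st vFL = encode_terms ts ->
  wp degrees_cmd st (fun st' k => [/\ st' vTd = VNat (tdeg f),
    st' vD = VNat (indeg f), st' vSz = VNat (size ts) &
    (k <= (size ts).+1 * (40 * n + 40) + 20)%N]).
Proof.
move=> f0 rts eN eM eF; do 4!(wps; rewrite /=); rewrite eN; wps.
apply: (wp_conseq (wp_for (k := n) (tb := 20%N)
  (J := fun j st => st vTd = VNat (\sum_(i < n | j <= i) mlead f i)%N) _ _ _ _)) => //.
- by rewrite /= big1 // => i; rewrite leqNgt ltn_ord.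
- move=> j st1 jn a1 e1; have eM1 : st1 vLM = VMonom (mlead f) by rewrite a1.
  wps; rewrite /= e1 eM1 /= (insub_ord jn) /=; split=> //.
  rewrite [in RHS](bigD1 (Ordinal jn)) //= addnC; congr (VNat (_ + _)).
  by apply: eq_bigl => i; rewrite ltn_neqAle andbC eq_sym.
move=> st1 k1 a1 [eT _ le_k1].
have eN1 : st1 vN = VNat n by rewrite a1.
have eF1 : st1 vFL = encode_terms ts by rewrite a1.
do 6!(wps; rewrite /=); rewrite eF1.
pose dg (m : 'X_{1..n}) := (\max_(i < n) m i)%N.
apply: (wp_conseq (wp_foreach (enc := enc) (ts := ts) (tb := fun=> (26 * n + 20)%N)
  (J := fun ts' st => exists T, [/\ ts = T ++ ts',
     st vD = VNat (\max_(t <- T) dg t.2)%N & st vSz = VNat (size T)]) _ _ _ _ _)) => //.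
- by exists [::]; rewrite big_nil.
- move=> t ts' st2 a2 [T [eTs eD eS]].
  have eN2 : st2 vN = VNat n by rewrite a2.
  do 4!(wps; rewrite /=); rewrite eS eN2 /=.
  apply: (wp_conseq (wp_for (k := n) (tb := 20%N)
    (J := fun j st => st vD = VNat (maxn (\max_(t <- T) dg t.2)
       (\max_(i < n | j <= i) t.2 i))%N) _ _ _ _)) => //.
  + rewrite /= eD; congr VNat; rewrite [X in maxn _ X]big1 ?maxn0 // => i.
    by rewrite leqNgt ltn_ord.
  + move=> j st3 jn a3 e3.
    have et3 : st3 vDt = enc t by rewrite a3.
    have -> : (\max_(i < n | j <= i) t.2 i =
        maxn (t.2 (Ordinal jn)) (\max_(i < n | j < i) t.2 i))%N.
      rewrite (bigD1 (Ordinal jn)) //=; congr maxn.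
      by apply: eq_bigl => i; rewrite ltn_neqAle andbC eq_sym.
    apply: wp_if; rewrite /= e3 et3 /= (insub_ord jn) /= truth_vbool => le_d.
      wps; rewrite /= et3 /= (insub_ord jn); split=> //; congr VNat.
      by rewrite maxnCA; apply/esym/maxn_idPl.
    wps; rewrite /= e3; split=> //; congr VNat.
    by rewrite maxnCA; apply/esym/maxn_idPr/ltnW; rewrite ltnNge.
  move=> st3 k3 a3 [eD3 _ le_k3]; split; first by lia.
  exists (rcons T t); rewrite cat_rcons size_rcons; split=> //.
    by rewrite eD3 -cats1 big_cat big_seq1.
  by rewrite a3 //= addn1.
move=> st' k a' [[T [eTs eD eS]] _ le_k].
rewrite cats0 in eTs; subst T; split=> //.
- by rewrite a' //= eT -(mdeg_lead f0) mdegE.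
- rewrite eD; congr VNat; rewrite /indeg.
  have /representsP pts := rts.
  by rewrite (perm_big _ pts) big_map.
- by rewrite sum_const_seq in le_k; lia.
Qed.

Lemma wp_bound st d D s W : st vD = VNat d -> st vTd = VNat D -> st vSz = VNat s ->
  (0 < W)%N -> (d <= W)%N -> (D <= W)%N -> (s <= W)%N ->
  wp bound_cmd st (fun st' k => st' vB = VNat (s ^ (9 * (D * d)))%N /\
    (k <= 500 * W ^ 3)%N).
Proof.
move=> eD eT eS W0 dW DW sW; do 4!(wps; rewrite /=); rewrite eT; wps.
apply: (wp_conseq (wp_for (k := D) (tb := 30%N)
  (J := fun j st => st vBk = VNat (9 * ((D - j) * d))) _ _ _ _)) => //.
- by rewrite /= subnn.
- move=> j st1 jD a1 e1; have eD1 : st1 vD = VNat d by rewrite a1.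
  wps; rewrite /= e1 eD1 /=; split=> //; congr VNat.
  have -> : (D - j = (D - j.+1).+1)%N by lia.
  by rewrite mulSn; lia.
move=> st1 k1 a1 [eK _ le_k1]; rewrite subn0 in eK.
do 4!(wps; rewrite /=); rewrite eK.
apply: (wp_conseq (wp_for (k := (9 * (D * d))%N) (tb := (20 * W + 20)%N)
  (J := fun j st => st vB = VNat (s ^ (9 * (D * d) - j))) _ _ _ _)) => //.
- by rewrite /= subnn.
- move=> j st2 jk a2 e2.
  have eS2 : st2 vSz = VNat s by rewrite a2 //= a1.
  do 4!(wps; rewrite /=); rewrite eS2; wps.
  apply: (wp_conseq (wp_for (k := s) (tb := 10%N)
    (J := fun i st => st vB2 = VNat ((s - i) * s ^ (9 * (D * d) - j.+1))) _ _ _ _)) => //.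
  + by rewrite /= subnn.
  + move=> i st3 si a3 e3.
    have eB3 : st3 vB = VNat (s ^ (9 * (D * d) - j.+1)) by rewrite a3 //= e2.
    wps; rewrite /= e3 eB3 /=; split=> //; congr VNat.
    have -> : (s - i = (s - i.+1).+1)%N by lia.
    by rewrite mulSn addnC.
  move=> st3 k3 a3 [e3 _ le_k3]; wps; rewrite /= e3 subn0; split; first by lia.
  by rewrite -expnS; congr (VNat (_ ^ _)); lia.
move=> st2 k2 a2 [e2 _ le_k2]; rewrite subn0 in e2; split=> //.
have le1 : (D * d <= W * W)%N by apply: leq_mul.
have le2 : (9 * (D * d) * (20 * W + 20 + 6) <= 9 * (W * W) * (20 * W + 20 + 6))%N.
  by apply: leq_mul; rewrite ?leq_mul2l ?le1 ?orbT.
have le3 : (W <= W * W)%N by rewrite leq_pmulr.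
have le4 : (W * W <= W * W * W)%N by rewrite leq_pmulr.
have -> : (W ^ 3 = W * W * W)%N by rewrite !expnS expn0; lia.
by lia.
Qed.

(** * Correctness and running time of the whole program *)

Section Correctness.
Variables (f : {mpoly F[n]}) (e : nat) (ts : seq (F * 'X_{1..n})).
Hypotheses (f_nc : nonconstant f) (e_gt1 : (1 < e)%N) (rts : represents ts f).
Let P := (e`_[pchar F])%N.
Let q := (e %/ P)%N.
Let c := mleadc f.
Let s := sparsity f.
Let d := indeg f.
Let D := tdeg f.
Let B := (s ^ (9 * (D * d)))%N.
Let W := (B + n + d + D + 1)%N.

Let f0 : f != 0.
Proof. by apply/eqP => f0; apply: (f_nc (c := 0)); rewrite f0 mpolyC0. Qed.

Let c0 : c != 0. Proof. by rewrite mleadc_eq0. Qed.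

Let e0 : (0 < e)%N. Proof. exact: ltnW. Qed.

Let Pq : e = (P * q)%N. Proof. by rewrite mulnC divnK // dvdn_part. Qed.

Let q0 : (0 < q)%N. Proof. by move: e0; rewrite Pq muln_gt0 => /andP[]. Qed.

Let le_qe : (q <= e)%N. Proof. exact: leq_div. Qed.

Let qF0 : q%:R != 0 :> F.
Proof.
by rewrite natf_neq0_pchar /q /P -{1}(partnC [pchar F] e0) mulKn ?part_pnat ?part_gt0.
Qed.

Let D0 : (0 < D)%N.
Proof.
rewrite lt0n /D -mdeg_lead // mdeg_eq0; apply: contra_notN (f_nc (c := c)) => /eqP lf.
have /msize1_polyC : (msize f <= 1)%N by rewrite -mlead_deg // lf mdeg0.
by rewrite /c lf.
Qed.

Let lead_f_pos : exists i, (0 < mlead f i)%N.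
Proof.
have := D0; rewrite /D -mdeg_lead // mdegE => H; apply/existsP.
apply: contraTT H => /existsPn H; rewrite -leqNgt leqn0 big1 // => i _.
by have := H i; lia.
Qed.

Let d0 : (0 < d)%N.
Proof.
have [i fi] := lead_f_pos; apply: leq_trans fi _.
by apply: mnm_le_indeg; apply: mlead_supp.
Qed.

Let n0 : (0 < n)%N.
Proof. by have [i _] := lead_f_pos; apply: leq_ltn_trans (ltn_ord i). Qed.

Let s0 : (0 < s)%N.
Proof. by rewrite lt0n /s /sparsity size_eq0 msupp_eq0. Qed.

Let sB : (s <= B)%N.
Proof. by rewrite /B -{1}[s]expn1 leq_pexp2l // !muln_gt0 D0 d0. Qed.

Lemma lead_root g : g ^+ e = f -> mlead f = (mlead g *+ e)%MM /\ mleadc g ^+ e = c.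
Proof.
move=> ge; have g0 : g != 0.
  by apply: contraNneq f0 => g0; rewrite -ge g0 expr0n; case: (e) e0.
have lf : mlead f = (mlead g *+ e)%MM by rewrite -ge mleadX.
by split; rewrite // -mleadcX ge -lf.
Qed.

(** Dividing by the leading coefficient turns any root of [f] into a monic root of [f / c], the
    target of the search, with a known leading monomial and sparse powers. *)
Lemma monic_root g (g' := (mleadc g)^-1 *: g) : g ^+ e = f ->
  [/\ g' ^+ e = c^-1 *: f, mleadc g' = 1, mlead g' = mnm_div (mlead f) e &
      bounded_powers g' q B].
Proof.
move=> ge; have [lf cg] := lead_root ge.
have cg0 : mleadc g != 0.
  by apply: contraNneq c0 => cg0; rewrite -cg cg0 expr0n; case: (e) e0.
have lg' : mlead g' = mlead g by rewrite mleadZ // invr_eq0.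
split.
- by rewrite exprZn ge exprVn cg.
- by rewrite lg' mcoeffZ mulVf.
- by rewrite lg' lf; apply/mnmP => i; rewrite mnmE mulmnE mulnK.
- move=> h i sub iq; apply: (root_power_sparsity (g := g) (e := e)) => //.
  + by move=> m /sub; rewrite (perm_mem (msuppZ _ _)) // invr_eq0.
  + exact: leq_trans iq le_qe.
  (* The strict inequality between the multiples 8 and 9 needs [D * d] positive, which holds as [f]
     is not constant. *)
  + by rewrite ltn_pmul2r // muln_gt0 D0.
Qed.

(** Any [b] with [b ^+ e = c] will do: once [h ^+ q = g1], the polynomial [b *: h] is a root of [f],
    whichever root of [c] was extracted. *)
Lemma wp_solve st G g1 b :
  st vN = VNat n -> st vE = VNat e -> st vFL = encode_terms ts ->
  st vLM = VMonom (mlead f) -> st vP = VNat P -> st vQ = VNat q ->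
  st vXq = VScalar q%:R -> st vG = encode_terms G -> st vRt = VScalar b ->
  (forall i, (e %| mlead f i)%N) -> (e <= W)%N ->
  b ^+ e = c -> represents G g1 -> g1 ^+ P = c^-1 *: f -> size G = size ts ->
  wp solve_cmd st (fun st' k => root_output f e (st' 0%N) /\ (k <= 2500 * W ^ 6)%N).
Proof.
move=> eN eE eF eM eP eQ eX eG eb dvd_e eW be rG eg1 sG.
have ss : size ts = s by apply: represents_size rts.
have W0 : (0 < W)%N by rewrite /W addn1.
have BW : (B < W)%N by rewrite /W; lia.
have sW : (size ts <= W)%N by rewrite ss; apply: leq_trans sB (ltnW BW).
have dW : (d <= W)%N by rewrite /W; lia.
have DW : (D <= W)%N by rewrite /W; lia.
have nW : (n <= W)%N by rewrite /W; lia.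
have qW : (q <= W)%N by apply: leq_trans le_qe eW.
have sGW : (size G <= W)%N by rewrite sG.
apply: wp_seq; apply: wp_conseq (wp_degrees f0 rts eN eM eF) _.
move=> st1 k1 a1 [eTd1 eD1 eSz1 le_k1].
apply: wp_seq.
apply: wp_conseq (wp_bound eD1 eTd1 eSz1 W0 dW DW sW) _ => st2 k2 a2 [eB2 le_k2].
rewrite ss -/B in eB2.
have eE2 : st2 vE = VNat e by rewrite a2 //= a1.
have eM2 : st2 vLM = VMonom (mlead f) by rewrite a2 //= a1.
have eP2 : st2 vP = VNat P by rewrite a2 //= a1.
have eQ2 : st2 vQ = VNat q by rewrite a2 //= a1.
have eX2 : st2 vXq = VScalar q%:R by rewrite a2 //= a1.
have eG2 : st2 vG = encode_terms G by rewrite a2 //= a1.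
have eb2 : st2 vRt = VScalar b by rewrite a2 //= a1.
do 6!(wps; rewrite /=); rewrite eM2 eE2 eP2 /=.
set m0 := mnm_div (mlead f) e.
(* Since [e = P * q] divides every exponent of the leading monomial, its quotient by [P] is [q]
   times [m0]. *)
have eSh : (mnm_div (mlead f) P - m0)%MM = (m0 *+ q.-1)%MM.
  apply/mnmP => i; rewrite mnmBE !mulmnE !mnmE.
  have -> : (mlead f i %/ P = mlead f i %/ e * q)%N.
    have /dvdnP[k ->] := dvd_e i.
    by rewrite mulnK // {1}Pq mulnCA mulKn ?part_gt0.
  by case: (q) q0 => // q' _; rewrite mulnS addKn.
rewrite eSh; apply: wp_seq.
apply: wp_conseq (wp_refine (G := G) (f := g1) (q := q) (B := B) (W := W)
  (m0 := m0) _ _ rG _ _ _ _ q0 qF0 W0 sGW BW qW) _ => //.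
move=> st3 k3 a3 [H [h [eH rH sH le_k3 hg]]].
have eG3 : st3 vG = encode_terms G by rewrite a3.
have eQ3 : st3 vQ = VNat q by rewrite a3.
have eB3 : st3 vB = VNat B by rewrite a3.
have eb3 : st3 vRt = VScalar b by rewrite a3.
apply: wp_seq.
apply: wp_conseq (wp_residual eH rH eG3 rG eQ3 eB3 W0 sH sGW (ltnW BW) qW) _ => //.
move=> st4 k4 a4 [A [r [eA rA hr hr' [sA le_k4]]]].
have W26 : (W ^ 2 <= W ^ 6)%N by apply: leq_pexp2l.
have W36 : (W ^ 3 <= W ^ 6)%N by apply: leq_pexp2l.
have W56 : (W ^ 5 <= W ^ 6)%N by apply: leq_pexp2l.
have W2 : (W <= W ^ 2)%N by rewrite -{1}[W]expn1 leq_pexp2l.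
have le_k1' : (k1 <= 200 * W ^ 2)%N.
  have : ((size ts).+1 * (40 * n + 40) <= (W + 1) * (40 * W + 40))%N.
    by apply: leq_mul; lia.
  by move: W2 le_k1; rewrite -mulnn; lia.
apply: wp_if; rewrite /= eA => tA.
  wps; rewrite /=; split; last first.
    by move: (W ^ 6)%N (W ^ 5)%N (W ^ 3)%N (W ^ 2)%N W2 W26 W36 W56
      le_k1' le_k2 le_k3 le_k4; lia.
  right; split=> // g ge; have [g'e g'1 lg' bg'] := monic_root ge.
  set g' := _ *: g in g'e g'1 lg' bg'.
  (* Both sides have the same [P]-th power, so injectivity of that power identifies them; a root
     would thus have been found. *)
  have g'q : g' ^+ q = g1.
    apply: (@expr_pchar_inj n F P); first exact: part_pnat.
    by rewrite -exprM mulnC -Pq g'e eg1.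
  have hE : h = g' by apply: hg.
  have rE : r = h ^+ q by apply: hr' => i iq; apply: bg' => //; rewrite hE.
  by move: rA tA; rewrite rE hE g'q subrr => /represents_nil ->.
have A0 : A = [::] by case: (A) tA.
have g1r : g1 = r.
  by case: rA => _ _; rewrite A0 /den big_nil => /esym/eqP; rewrite subr_eq0 => /eqP.
(* This rules out that the zero residual comes from a power cut off to 0. *)
have r0 : r != 0.
  rewrite -g1r; apply/eqP => g10; move/eqP: eg1; rewrite g10.
  rewrite expr0n gtn_eqF ?part_gt0 // eq_sym scaler_eq0 invr_eq0.
  by rewrite (negbTE c0) (negbTE f0).
have rE : r = h ^+ q by case: hr r0 => // ->; rewrite eqxx.
have eH4 : st4 vH = encode_terms H by rewrite a4.
have eb4 : st4 vRt = VScalar b by rewrite a4.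
do 8!(wps; rewrite /=); rewrite eH4 eb4; wps.
have r00 : represents [::] (0 : {mpoly F[n]}) by apply/represents_nil.
apply: wp_conseq (wp_axpy (L := [::]) (L2 := H) (c := b) (m := 0%MM)
  _ r00 _ _ _) _ => //.
move=> st5 k5 _ [L [eL rL _ le_k5]]; wps; rewrite /= eL; split; last first.
  have : (size H * (30 * (0 + size H) + 60) <= W * (30 * W + 60))%N.
    by apply: leq_mul; lia.
  have -> : (W * (30 * W + 60) = 30 * W ^ 2 + 60 * W)%N by rewrite -mulnn; lia.
  by move: (W ^ 6)%N (W ^ 5)%N (W ^ 3)%N (W ^ 2)%N W2 W26 W36 W56
      le_k1' le_k2 le_k3 le_k4 le_k5 => /=; lia.
left; exists (b *: h).
  apply/sparse_reprP; exists L => //.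
  case: rH => _ _ dH; move: rL.
  by rewrite dH add0r mpolyX0 -scalerAl mul1r.
by rewrite exprZn be Pq mulnC exprM -rE -g1r eg1 scalerA divff // scale1r.
Qed.

(** Each early failure refutes a necessary condition: [e] divides the leading exponents, [c] has an
    [e]-th root, and [f / c] has a [P]-th root. *)
Lemma wp_root_cmd :
  wp root_cmd (init_store (root_input e (encode_terms ts))) (fun st' k =>
    root_output f e (st' 0%N) /\ (k <= 4000 * W ^ 6 + s * R e)%N).
Proof.
have ss : size ts = s by apply: represents_size rts.
have W0 : (0 < W)%N by rewrite /W addn1.
have BW : (B < W)%N by rewrite /W; lia.
have sW : (s <= W)%N by apply: leq_trans sB (ltnW BW).
have W1 : (W <= W ^ 6)%N by rewrite -{1}[W]expn1 leq_pexp2l.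
do 8!(wps; rewrite /= /init_store /root_input /=); wps.
apply: wp_conseq (wp_lead (L := ts) (p := f) _ rts) _ => //.
move=> st1 k1 a1 [eLc eLm le_k1]; rewrite ss in le_k1.
have eN1 : st1 vN = VNat n by rewrite a1.
have eE1 : st1 vE = VNat e by rewrite a1.
have eF1 : st1 vFL = encode_terms ts by rewrite a1.
do 4!(wps; rewrite /=); rewrite eLc eLm.
apply: wp_if; rewrite /= eE1 /= truth_vbool => dvd_e; last first.
  wps; rewrite /=; split; last by lia.
  right; split=> // g ge; case/negP: dvd_e; apply/forallP => i.
  by have [-> _] := lead_root ge; rewrite mulmnE dvdn_mull.
move/forallP: dvd_e => dvd_e.
(* A positive leading exponent is a multiple of [e], so [e <= d]; the loops counting up to [e] are
   therefore affordable. *)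
have eW : (e <= W)%N.
  have [i fi] := lead_f_pos; apply: leq_trans (dvdn_leq fi (dvd_e i)) _.
  apply: leq_trans (mnm_le_indeg _ (mlead_supp f0)) _.
  by rewrite /W -/d; lia.
apply/wp_seq/(wp_root (k := e) (a := c)) => //=.
have := scalar_rootP O c e0; case: (scalar_root O e c) => [b|] /= be; last first.
  apply: wp_if; rewrite /= ?truth_vbool // => _; wps; rewrite /=; split.
    by right; split=> // g ge; have [_ /be] := lead_root ge.
  have : (R e <= s * R e)%N by rewrite leq_pmull.
  by lia.
apply: wp_if; rewrite /= ?truth_vbool // => _.
apply: wp_seq.
apply: wp_conseq (wp_split _ e0 n0) _ => /=; first exact: eE1.
move=> st2 k2 a2 [eP2 eQ2 eX2 le_k2]; rewrite -/P -/q in eP2 eQ2 eX2.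
have eE2 : st2 vE = VNat e by rewrite a2.
have eF2 : st2 vFL = encode_terms ts by rewrite a2.
have eC2 : st2 vLC = VScalar c by rewrite a2.
have eM2 : st2 vLM = VMonom (mlead f) by rewrite a2.
apply: wp_seq.
apply: wp_conseq (wp_frob_cmd rts f0 e0 eE2 eP2 eF2 eC2 eM2) _.
move=> st3 k3 a3 [ok [eO3 okG rootG le_k3]]; rewrite ss in le_k3.
(* One root of [c] and at most [s - 1] Frobenius roots make up the charge [s * R e]. *)
have Re : (R e + s.-1 * R e = s * R e)%N by rewrite -mulSn prednK.
have le_k2' : (k2 <= 20 * W ^ 2 + 150 * W + 20)%N.
  apply: leq_trans le_k2 _; rewrite leq_add2r -mulnn.
  apply: leq_trans (_ : W * (20 * W + 150) <= _)%N; last by lia.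
  by apply: leq_mul; lia.
have W26 : (W ^ 2 <= W ^ 6)%N by apply: leq_pexp2l.
apply: wp_if; rewrite /= eO3 truth_vbool => okT; last first.
  wps; rewrite /=; split; last first.
    by move: (W ^ 6)%N (W ^ 2)%N W1 W26 le_k2' => W6 W2; lia.
  right; split=> // g ge; case/negP: okT.
  have [g'e _ _ _] := monic_root ge.
  by apply: (rootG (((mleadc g)^-1 *: g) ^+ q)); rewrite -exprM mulnC -Pq.
have [G [g1 [eG rG eg1 sG]]] := okG okT.
apply: wp_conseq (wp_solve (st := st3) (G := G) (g1 := g1) (b := b) _ _ _ _ _ _ _ eG _
   dvd_e eW be rG eg1 sG) _.
- by rewrite a3 //= a2.
- by rewrite a3.
- by rewrite a3.
- by rewrite a3.
- by rewrite a3.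
- by rewrite a3.
- by rewrite a3.
- by rewrite a3 //= a2.
move=> st4 k4 _ [out le_k4]; split=> //.
by move: (W ^ 6)%N (W ^ 2)%N W1 W26 le_k2' le_k4 => W6 W2; lia.
Qed.

End Correctness.

End RootAlgorithm.

Theorem theorem5p2 :
  exists (prog : cmd) (Q : {mpoly int[4]}) (C : nat),
  forall (F : fieldType) (O : scalar_roots F) (R : nat -> nat)
         (n : nat) (f : {mpoly F[n]}) (e : nat) (v : value F n),
    nonconstant f -> (2 <= e)%N -> sparse_repr f v ->
    let s := sparsity f in
    let d := indeg f in
    let D := tdeg f in
    exists (st : store F n) (t : nat),
      [/\ exec O R prog (init_store (root_input e v)) st t,
          root_output f e (st 0%N)
        & t%:Z <= poly4 Q (s ^ (C * (D * d)))%N n d D + (s * R e)%:Z].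
Proof.
(* The sum of the four variables plus 1 evaluates to the size parameter [W] of the cost bound
   [4000 * W ^ 6]. *)
exists root_cmd, (4000%:R *: (\sum_(i < 4) 'X_i + 1) ^+ 6), 9%N.
move=> F O R n f e v f_nc e_gt1 /sparse_reprP[ts rts ->] s d D.
have [st [t [ex [out le_t]]]] := wp_root_cmd O R f_nc e_gt1 rts.
exists st, t; split=> //.
rewrite /poly4 mevalZ rmorphXn rmorphD rmorph_sum /= rmorph1.
rewrite !big_ord_recl big_ord0 /= !mevalXU /=.
rewrite [X in X ^+ 6](_ : _ = (s ^ (9 * (D * d)) + n + d + D + 1)%N%:Z); last by lia.
have powz (a : nat) : a%:Z ^+ 6 = (a ^ 6)%N%:Z by rewrite -!natz natrX.
by rewrite powz -PoszM -PoszD.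
Qed.
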